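(* Let $K$ be a field, let $G$ be a finite simple graph with vertex set $V(G)=\{x_1,\ldots,x_n\}$ and with at least one edge, and let $R=K[x_1,\ldots,x_n]$. Then $R/I(G)$ is Cohen-Macaulay if and only if $\mathrm{v}(J(G))=\mathrm{reg}(R/J(G))=\alpha_0(G)-1$.
   Context: $R=K[x_1,\ldots,x_n]=\bigoplus_{d\ge 0}R_d$ has the standard grading; the vertices of $G$ are identified with the variables of $R$. The edge ideal of $G$ is $I(G)=\langle x_ix_j : \{x_i,x_j\}\in E(G)\rangle\subseteq R$. A vertex cover of $G$ is a set $C\subseteq V(G)$ meeting every edge; it is minimal if it is minimal under inclusion. $\alpha_0(G)$ denotes the minimum cardinality of a vertex cover of $G$ (equal to the height of $I(G)$). For $C\subseteq V(G)$ put $X_C=\prod_{x_i\in C}x_i$. The cover ideal of $G$ is $J(G)=\langle X_C : C \text{ a minimal vertex cover of } G\rangle=\bigcap_{\{x_i,x_j\}\in E(G)}\langle x_i,x_j\rangle$. For a proper graded ideal $I\subseteq R$, the $\mathrm{v}$-number is $\mathrm{v}(I)=\min\{d\ge 0 : \text{there exist } f\in R_d \text{ and } \mathfrak p\in \mathrm{Ass}(I) \text{ with } I:f=\mathfrak p\}$, where $\mathrm{Ass}(I)$ is the set of associated primes of $I$ (i.e. of $R/I$). $\mathrm{reg}(R/I)=\max\{j-i : \beta_{i,j}(R/I)\ne 0\}$ is the Castelnuovo-Mumford regularity, where $\beta_{i,j}(R/I)$ are the graded Betti numbers of $R/I$ over $R$. *)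

(* Defs.v *)
From HB Require Import structures.
From mathcomp Require Import all_boot all_order all_algebra.
From mathcomp Require Import mpoly.

Set Implicit Arguments.
Unset Strict Implicit.
Unset Printing Implicit Defensive.

Import GRing.Theory.
Local Open Scope ring_scope.

Definition is_min (P : nat -> Prop) (d : nat) : Prop :=
  P d /\ forall e, P e -> (d <= e)%N.

Definition is_max (P : nat -> Prop) (d : nat) : Prop :=
  P d /\ forall e, P e -> (e <= d)%N.

Section Ideals.

Variable A : comNzRingType.
Implicit Types (S I P : A -> Prop) (f g : A).

Definition ideal_gen S f : Prop :=
  exists s : seq (A * A),
    (forall q, q \in s -> S q.2) /\ f = \sum_(q <- s) q.1 * q.2.

Definition is_ideal I : Prop :=
  [/\ I 0, forall f g, I f -> I g -> I (f + g) & forall a f, I f -> I (a * f)].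

Definition is_prime P : Prop :=
  [/\ is_ideal P, ~ P 1 & forall f g, P (f * g) -> P f \/ P g].

Definition colon I f : A -> Prop := fun g => I (g * f).

(* The annihilators of elements of A/I are exactly the ideals colon I g. *)
Definition is_associated I P : Prop :=
  is_prime P /\ exists g, forall h, colon I g h <-> P h.

Definition has_prime_chain I (d : nat) : Prop :=
  exists P : nat -> A -> Prop,
    (forall k, (k <= d)%N -> is_prime (P k) /\ forall f, I f -> P k f) /\
    (forall k, (k < d)%N ->
       (forall f, P k f -> P k.+1 f) /\ exists f, P k.+1 f /\ ~ P k f).

(* d is the Krull dimension of A/I. *)
Definition is_krull_dim I (d : nat) : Prop := is_max (has_prime_chain I) d.

(* I + (s_0, ..., s_(r-1)) *)
Definition ideal_plus I (s : seq A) : A -> Prop :=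
  ideal_gen (fun f => I f \/ f \in s).

(* s is a regular sequence on A/I. *)
Definition regular_seq I (s : seq A) : Prop :=
  ~ ideal_plus I s 1 /\
  forall k, (k < size s)%N ->
    forall g, ideal_plus I (take k s) (s`_k * g) -> ideal_plus I (take k s) g.

End Ideals.

Section Graded.

Variables (K : fieldType) (n : nat).
Local Notation R := {mpoly K[n]}.
Implicit Type I : R -> Prop.

(* f lies in the ideal (x_1, ..., x_n). *)
Definition irrelevant (f : R) : Prop := f@_(0%MM) = 0.

(* d is the depth of the graded ring R/I, for I a proper graded ideal. *)
Definition is_depth I (d : nat) : Prop :=
  is_max (fun r => exists s : seq R,
    [/\ size s = r, (forall f, f \in s -> irrelevant f) & regular_seq I s]) d.

(* R/I is Cohen-Macaulay, for I a proper graded ideal. *)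
Definition cohen_macaulay I : Prop :=
  exists d, is_depth I d /\ is_krull_dim I d.

Definition is_v_number I (d : nat) : Prop :=
  is_min (fun e => exists (f : R) (P : R -> Prop),
    [/\ f \is e.-homog, is_associated I P & forall g, colon I f g <-> P g]) d.

(* Graded free modules F_i = \bigoplus_k R(- fc_shift i k), written as row
   vectors, with maps F_(i+1) -> F_i, v |-> v *m fc_diff i, and a map F_0 -> R/I,
   v |-> v *m fc_aug mod I. *)
Record free_complex := FreeComplex {
  fc_rank : nat -> nat;
  fc_shift : forall i, 'I_(fc_rank i) -> nat;
  fc_diff : forall i, 'M[R]_(fc_rank i.+1, fc_rank i);
  fc_aug : 'cV[R]_(fc_rank 0)
}.

(* In the first clause, fc_diff i k l is homogeneous of degree
   fc_shift i.+1 k - fc_shift i l, and 0 if this integer is negative. *)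
Definition degree_preserving (F : free_complex) : Prop :=
  (forall i k l (m : 'X_{1..n}), m \in msupp (fc_diff F i k l) ->
     (mdeg m + fc_shift l = fc_shift k)%N) /\
  (forall k, fc_aug F k 0 \is (fc_shift k).-homog).

Definition resolves (F : free_complex) I : Prop :=
  [/\ forall f, exists v : 'rV[R]_(fc_rank F 0), I (f - (v *m fc_aug F) 0 0),
      forall v : 'rV[R]_(fc_rank F 0),
        I ((v *m fc_aug F) 0 0) <-> exists w, v = w *m fc_diff F 0
    & forall i (v : 'rV[R]_(fc_rank F i.+1)),
        v *m fc_diff F i = 0 <-> exists w, v = w *m fc_diff F i.+1].

Definition minimal (F : free_complex) : Prop :=
  forall i k l, irrelevant (fc_diff F i k l).

Definition minimal_graded_free_resolution (F : free_complex) I : Prop :=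
  [/\ degree_preserving F, resolves F I & minimal F].

Definition betti (F : free_complex) (i j : nat) : nat :=
  #|[pred k : 'I_(fc_rank F i) | fc_shift k == j]|.

(* d = reg(R/I).  The graded Betti numbers are read off a minimal graded free
   resolution of R/I, which is unique up to isomorphism.  In it
   betti F i j != 0 forces i <= j, so no value j - i is negative. *)
Definition is_regularity I (d : nat) : Prop :=
  exists F : free_complex, minimal_graded_free_resolution F I /\
    is_max (fun r => exists i j, betti F i j <> 0%N /\ j = (i + r)%N) d.

End Graded.

Section Graphs.

Variables (K : fieldType) (n : nat) (e : rel 'I_n).
Local Notation R := {mpoly K[n]}.

Definition vertex_cover (C : {set 'I_n}) : bool :=
  [forall i, forall j, e i j ==> (i \in C) || (j \in C)].

Definition min_vertex_cover (C : {set 'I_n}) : bool := minset vertex_cover C.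

Definition alpha0 : nat :=
  #|[arg min_(C < [set: 'I_n] | vertex_cover C) #|C|]%N|.

Definition edge_ideal : R -> Prop :=
  ideal_gen (fun f => exists i j, e i j /\ f = 'X_i * 'X_j).

Definition cover_ideal : R -> Prop :=
  ideal_gen (fun f => exists C, min_vertex_cover C /\ f = \prod_(i in C) 'X_i).

End Graphs.

Arguments edge_ideal K {n} e _.
Arguments cover_ideal K {n} e _.

(* Main.v *)
(* The theorem is the Eagon-Reiner theorem for the complex D of independent sets
   of the graph, together with the v-number of the cover ideal J in the
   Cohen-Macaulay case.  With d = n - alpha0, both sides are compared with one
   condition: for every F, the complex of the link of F in D is exact below
   size d - |F| (sizes of faces of the link).

   Cohen-Macaulay => links.  A regular sequence of length d forces the Koszul
   cohomology of R/I on the squares of the variables to vanish below degree d,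
   and the cochain complexes of the links are among its multigraded strands.

   Links => Cohen-Macaulay.  A squarefree module M with exact links embeds in a
   direct sum C of polynomial rings K[x_G], |G| = d, and the links of C/M are
   exact below d - 1.  By induction on d the elementary symmetric polynomials
   e_1, ..., e_d form a regular sequence on M.

   Links <=> linear resolution.  The chain complexes of the links are the
   squarefree strands of the Koszul complex of J; cochains are turned into chains
   by duality over K.  Vanishing of the Koszul homology of J outside the linear
   degrees allows one to build the linear resolution step by step; conversely a
   minimal resolution computes Koszul homology by dimension shifting.

   Since J has no generator in degree below alpha0, reg(R/J) = alpha0 - 1 says
   exactly that J has a linear resolution.  In the v-number the bound
   v >= alpha0 - 1 holds always, and equality comes from two facets of D
   which differ in one vertex. *)
From HB Require Import structures.
Require Import Defs.
From mathcomp Require Import all_boot all_order all_algebra.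
From mathcomp Require Import mpoly ring zify.
From Stdlib Require Import ClassicalEpsilon Lia.

Set Implicit Arguments.
Unset Strict Implicit.
Unset Printing Implicit Defensive.

Import GRing.Theory.
Local Open Scope ring_scope.

(** * Polynomials with prescribed monomials *)

(** Cohen-Macaulayness compares two maxima, depth and Krull dimension. One counting argument bounds
    both by [d]: products of powers of the given elements are linearly independent and would
    otherwise outnumber the monomials outside the edge ideal. What remains is whether some regular
    sequence has length [d]. The other direction uses squares of variables because multiplication by
    a square preserves the parity of exponents: the exponent 1 marks the vertices of [F], and no
    differential can create or remove it. Uniqueness of minimal resolutions is avoided: one
    direction constructs a resolution, indexed by all of [nat], and the other works with whichever
    resolution is given. Complements turn faces into covers, so the link of [F] sits in the
    multidegree supported on the complement of [F]. *)

Lemma choice_fun (A B : Type) (P : A -> B -> Prop) :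
  (forall a, exists b, P a b) -> exists f : A -> B, forall a, P a (f a).
Proof.
move=> H; exists (fun a => proj1_sig (constructive_indefinite_description _ (H a))).
by move=> a; case: constructive_indefinite_description.
Qed.

Lemma choice_ffun (A : finType) (B : Type) (P : A -> B -> Prop) :
  (forall a, exists b, P a b) -> exists f : {ffun A -> B}, forall a, P a (f a).
Proof.
by move=> /choice_fun[f Hf]; exists [ffun a => f a] => a; rewrite ffunE.
Qed.

Lemma is_max_unique P d1 d2 : is_max P d1 -> is_max P d2 -> d1 = d2.
Proof.
by case=> p1 m1 [p2 m2]; apply/eqP; rewrite eqn_leq m1 // m2.
Qed.

Section MonomialSpans.

Variables (K : fieldType) (n : nat).
Local Notation R := {mpoly K[n]}.
Implicit Types (f g : R) (m a b : 'X_{1..n}) (P Q : pred 'X_{1..n}).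

Definition mpart P f : R := \sum_(m <- msupp f | P m) f@_m *: 'X_[m].

Lemma mcoeff_mpart P f m : (mpart P f)@_m = if P m then f@_m else 0.
Proof.
rewrite /mpart raddf_sum /=.
case: ifPn => [Pm|nPm]; last first.
  apply: big1 => a Pa; rewrite mcoeffZ mcoeffX.
  by case: eqP => [e|]; rewrite ?mulr0 //; rewrite -e Pa in nPm.
have [ms|ms] := boolP (m \in msupp f).
  rewrite (big_rem m) //= Pm mcoeffZ mcoeffX eqxx mulr1 big_seq_cond big1 ?addr0 //.
  move=> a /andP[]; rewrite mem_rem_uniq // => /andP[/= /negPf am _] _.
  by rewrite mcoeffZ mcoeffX am mulr0.
rewrite (memN_msupp_eq0 ms) big_seq_cond big1 // => a /andP[as_ _].
rewrite mcoeffZ mcoeffX; case: eqP => [e|]; rewrite ?mulr0 //.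
by rewrite e (negPf ms) in as_.
Qed.

Fact mpart_is_linear P : linear (mpart P).
Proof.
move=> c f g; apply/mpolyP => m; rewrite !(mcoeff_mpart, mcoeffD, mcoeffZ).
by case: ifP; rewrite ?mulr0 ?addr0.
Qed.
HB.instance Definition _ P :=
  GRing.isLinear.Build K R R _ (mpart P) (mpart_is_linear P).

(** Monomial ideals, homogeneity and degree bounds are all expressed by this one predicate, so that
    [mono2M] controls products in every case. *)
Definition mono P f := forall m, f@_m != 0 -> P m.

Lemma mono0 P : mono P 0.
Proof. by move=> m; rewrite mcoeff0 eqxx. Qed.

Lemma monoD P f g : mono P f -> mono P g -> mono P (f + g).
Proof.
move=> hf hg m; rewrite mcoeffD.
have [->|/hf//] := eqVneq f@_m 0; rewrite add0r; exact: hg.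
Qed.

Lemma monoN P f : mono P f -> mono P (- f).
Proof. by move=> hf m; rewrite mcoeffN oppr_eq0; exact: hf. Qed.

Lemma mono_sum P (I : Type) (r : seq I) (p : pred I) (F : I -> R) :
  (forall i, p i -> mono P (F i)) -> mono P (\sum_(i <- r | p i) F i).
Proof. by move=> h; elim/big_ind: _ => //; [exact: mono0|exact: monoD]. Qed.

Lemma monoZ P c f : mono P f -> mono P (c *: f).
Proof.
move=> hf m; rewrite mcoeffZ => H; apply: hf.
by apply: contra_neq H => ->; rewrite mulr0.
Qed.

Lemma monoXm P m : mono P 'X_[m] <-> P m.
Proof.
split=> [h|h a]; first by apply: h; rewrite mcoeffX eqxx oner_eq0.
by rewrite mcoeffX; have [<-//|_] := eqVneq m a; rewrite eqxx.
Qed.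

Lemma mono1 P : P 0%MM -> mono P 1.
Proof. by move=> h; rewrite -mpolyX0; apply/monoXm. Qed.

Lemma mono_mpart P f : mono P (mpart P f).
Proof. by move=> m; rewrite mcoeff_mpart; case: ifP; rewrite ?eqxx. Qed.

Lemma mpart_mono P f : mono P f -> mpart P f = f.
Proof.
move=> h; apply/mpolyP => m; rewrite mcoeff_mpart; case: ifPn => // nP.
by apply/esym/eqP; apply: contraNT nP => /h.
Qed.

Lemma mono_mpartI P Q f : mono P f -> mono P (mpart Q f).
Proof. by move=> h m; rewrite mcoeff_mpart; case: ifP => [_ /h|]; rewrite ?eqxx. Qed.

Lemma eq_mono P Q f : P =1 Q -> mono P f -> mono Q f.
Proof. by move=> e h m; rewrite -e; exact: h. Qed.

Lemma sub_mono P Q f : (forall m, P m -> Q m) -> mono P f -> mono Q f.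
Proof. by move=> e h m /h/e. Qed.

Lemma mono2M P Q (T : pred 'X_{1..n}) f g :
    (forall a b, P a -> Q b -> T (a + b)%MM) ->
  mono P f -> mono Q g -> mono T (f * g).
Proof.
move=> h hf hg m; rewrite -mcoeff_msupp => /msuppM_le/allpairsP[[a b] /= [ha hb ->]].
by apply: h; [apply: hf|apply: hg]; rewrite -mcoeff_msupp.
Qed.

Lemma monoMr P f g :
  (forall a b, P b -> P (a + b)%MM) -> mono P g -> mono P (f * g).
Proof. by move=> h; apply: (@mono2M predT) => // a b _; exact: h. Qed.

Lemma mcoeffXM m f a :
  ('X_[m] * f)@_a = if (m <= a)%MM then f@_(a - m) else 0.
Proof.
case: ifPn => [/submK e|nle]; first by rewrite -{1}e mulrC addmC mcoeffMX.
apply/eqP; apply: contraNT nle; rewrite -mcoeff_msupp mulrC.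
by rewrite (perm_mem (msuppMX f m)) => /mapP[b _ ->]; rewrite lem_addr.
Qed.

Lemma mcoeffXUM k f a :
  ('X_k * f)@_a = if a k != 0%N then f@_(a - U_(k)) else 0.
Proof. by rewrite mcoeffXM lep1mP. Qed.

Lemma mono_ideal P : (forall a b, P b -> P (a + b)%MM) -> is_ideal (mono P).
Proof.
move=> h; split; [exact: mono0|exact: monoD|move=> a f hf; exact: monoMr].
Qed.

(** Assembles coefficients chosen one monomial at a time into a polynomial; the cut at [N] makes the
    sum finite. *)
Definition mtrunc (N : nat) (E : 'X_{1..n} -> K) : R :=
  \sum_(m : 'X_{1..n < N}) E m *: 'X_[m].

Lemma mcoeff_mtrunc N E m : (mtrunc N E)@_m = if (mdeg m < N)%N then E m else 0.
Proof.
case: ifP => h; first exact: mcoeff_mpoly.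
rewrite /mtrunc raddf_sum /= big1 // => a _; rewrite mcoeffZ mcoeffX.
have [am|_] := eqVneq (bmnm a) m; last by rewrite mulr0.
by rewrite -am bmdeg in h.
Qed.

(* Each monomial is charged to one variable whose [e]-th power divides it. *)
Lemma mono_powers (e : nat) f :
    mono (fun m => [exists k : 'I_n, e <= m k]%N) f ->
  exists r : 'I_n -> R, f = \sum_k r k * 'X_k ^+ e.
Proof.
move=> h.
pose p m := [pick k : 'I_n | (e <= m k)%N].
exists (fun k => \sum_(m <- msupp f | p m == Some k) f@_m *: 'X_[m - U_(k) *+ e]).
rewrite {1}(mpolyE f).
under [RHS]eq_bigr => k _ do rewrite mulr_suml.
rewrite (exchange_big_dep predT) //= big_seq [RHS]big_seq.
apply: eq_bigr => m; rewrite mcoeff_msupp => /h/existsP[k0 hk0].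
rewrite /p; case: pickP => [k hk|/(_ k0)]; last by rewrite hk0.
rewrite (big_pred1 k) => [|j]; last by rewrite /= eq_sym.
rewrite -scalerAl mpolyXn -mpolyXD submK //.
apply/mnm_lepP => i; rewrite mulmnE mnm1E; case: eqP => [<-|] //=.
by rewrite mul1n.
Qed.

Lemma irrelevantP f : irrelevant f <-> mono (fun m => m != 0%MM) f.
Proof.
split=> [h m|h]; first by apply: contraNneq => ->; apply/eqP.
by apply/eqP; apply: contraTT isT => /h; rewrite eqxx.
Qed.

End MonomialSpans.
Arguments mono {K n} P f.
Arguments mpart {K n} P f.

(** * The edge ideal and the cover ideal *)

Lemma ideal_gen_sub (A : comNzRingType) (S : A -> Prop) f : S f -> ideal_gen S f.
Proof.
move=> Sf; exists [:: (1, f)]; split=> [q|]; first by rewrite inE => /eqP->.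
by rewrite big_seq1 mul1r.
Qed.

Lemma eq_ideal_gen (A : comNzRingType) (S S' : A -> Prop) f :
  (forall g, S g <-> S' g) -> ideal_gen S f <-> ideal_gen S' f.
Proof. by move=> h; split=> [] [s [hs ->]]; exists s; split=> // q /hs/h. Qed.

Lemma ideal_gen_is_ideal (A : comNzRingType) (S : A -> Prop) :
  is_ideal (ideal_gen S).
Proof.
split=> [|f g [s [hs ->]] [t [ht ->]]|a f [s [hs ->]]].
- by exists [::]; rewrite big_nil.
- exists (s ++ t); split=> [q|]; last by rewrite big_cat.
  by rewrite mem_cat => /orP[/hs|/ht].
- exists [seq (a * q.1, q.2) | q <- s]; split=> [q /mapP[p /hs hp ->] //|].
  by rewrite big_map mulr_sumr; apply: eq_bigr => q _; rewrite mulrA.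
Qed.

Lemma ideal_gen_min (A : comNzRingType) (S I : A -> Prop) f :
  is_ideal I -> (forall g, S g -> I g) -> ideal_gen S f -> I f.
Proof.
move=> [I0 ID IM] SI [s [hs ->]]; rewrite big_seq.
by elim/big_ind: _ => // q qs; apply/IM/SI/hs.
Qed.

Lemma ideal_opp (A : comNzRingType) (I : A -> Prop) f : is_ideal I -> I f -> I (- f).
Proof. by case=> _ _ IM If; rewrite -mulN1r; apply: IM. Qed.

Lemma ideal_sub (A : comNzRingType) (I : A -> Prop) f g :
  is_ideal I -> I f -> I g -> I (f - g).
Proof. by move=> idI If Ig; case: (idI) => _ ID _; apply: ID => //; apply: ideal_opp. Qed.

Section Supports.

Variable n : nat.
Implicit Types (m a b : 'X_{1..n}) (S T F : {set 'I_n}).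

Definition supp m : {set 'I_n} := [set i | m i != 0%N].

Lemma mem_mesym1 S i : mesym1 S i = (i \in S).
Proof. by rewrite mnmE. Qed.

Lemma supp_mesym1 S : supp (mesym1 S) = S.
Proof. by apply/setP => i; rewrite inE mem_mesym1; case: (i \in S). Qed.

Lemma suppD a b : supp (a + b)%MM = supp a :|: supp b.
Proof. by apply/setP => i; rewrite !inE mnmDE addn_eq0 negb_and. Qed.

Lemma mesym1_le S m : (mesym1 S <= m)%MM = (S \subset supp m).
Proof.
apply/mnm_lepP/subsetP => h i.
  by move=> iS; have := h i; rewrite mem_mesym1 iS inE lt0n.
by rewrite mem_mesym1; case: (boolP (i \in S)) => // /h; rewrite inE lt0n.
Qed.

Lemma card_supp_le m : (#|supp m| <= mdeg m)%N.
Proof.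
rewrite mdegE -sum1_card big_mkcond /=; apply: leq_sum => i _.
by rewrite inE; case: (m i).
Qed.

Lemma supp_sub_le a b : (a <= b)%MM -> supp a \subset supp b.
Proof.
move=> /mnm_lepP h; apply/subsetP => i; rewrite !inE -!lt0n => /leq_trans; exact.
Qed.

End Supports.

Section GraphIdeals.

Variables (K : fieldType) (n : nat) (e : rel 'I_n).
Local Notation R := {mpoly K[n]}.
Implicit Types (f g : R) (m a b : 'X_{1..n}) (S T F G C D : {set 'I_n}).

Lemma ideal_gen_mono (G : 'X_{1..n} -> Prop) (P : pred 'X_{1..n}) f :
    (forall m, P m <-> exists a, G a /\ (a <= m)%MM) ->
  ideal_gen (fun f : R => exists a, G a /\ f = 'X_[a]) f <-> mono P f.
Proof.
move=> GP; have upP a b : P b -> P (a + b)%MM.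
  move/GP=> [c [Gc cb]]; apply/GP; exists c; split=> //.
  exact: (lepm_trans cb (lem_addl a b)).
split; first apply: ideal_gen_min; first exact: mono_ideal.
  by move=> _ [a [Ga ->]]; apply/monoXm/GP; exists a; rewrite lepm_refl.
move=> /= h; rewrite (mpolyE f) big_seq.
have [I0 ID IM] := @ideal_gen_is_ideal R (fun f : R => exists a, G a /\ f = 'X_[a]).
elim/big_ind: _ => // m; rewrite mcoeff_msupp => /h/GP[a [Ga am]].
rewrite -(submK am) mpolyXD -mul_mpolyC mulrA; apply: IM; apply: ideal_gen_sub.
by exists a.
Qed.

Lemma vertex_coverS C D : C \subset D -> vertex_cover e C -> vertex_cover e D.
Proof.
move=> /subsetP CD /forallP h; apply/forallP => i; apply/forallP => j.
apply/implyP => eij; have /forallP/(_ j)/implyP/(_ eij) := h i.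
by case/orP=> /CD ->; rewrite ?orbT.
Qed.

Lemma vertex_coverP C :
  reflect (forall i j, e i j -> (i \in C) || (j \in C)) (vertex_cover e C).
Proof.
apply: (iffP forallP) => h i; first by move=> j; apply/implyP; have /forallP := h i.
by apply/forallP => j; apply/implyP; exact: h.
Qed.

(** Independence is phrased through the complement because faces of the independence complex and
    squarefree monomials of the cover ideal correspond by complementation. *)
Definition indep F := vertex_cover e (~: F).

Lemma indepP F : reflect (forall i j, i \in F -> j \in F -> ~~ e i j) (indep F).
Proof.
apply: (iffP (vertex_coverP _)) => h i j.
  move=> iF jF; apply/negP => /h; by rewrite !inE iF jF.
by move=> eij; rewrite !inE -negb_and; apply/negP => /andP[iF /(h _ _ iF)]; rewrite eij.
Qed.

Lemma indepS F G : F \subset G -> indep G -> indep F.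
Proof. by move=> FG; apply: vertex_coverS; rewrite setCS. Qed.

Lemma edge_idealE f : irreflexive e ->
  edge_ideal K e f <-> mono (fun m => ~~ indep (supp m)) f.
Proof.
move=> e_irr; apply: iff_trans (ideal_gen_mono
  (G := fun a => exists i j, e i j /\ a = (U_(i) + U_(j))%MM) _ _) => [|m].
  apply: eq_ideal_gen => g; split=> [[i [j [eij ->]]]|[_ [[i [j [eij ->]]] ->]]].
    by exists (U_(i) + U_(j))%MM; rewrite mpolyXD; split=> //; exists i, j.
  by exists i, j; rewrite mpolyXD.
split.
  rewrite /indep negb_forall => /existsP[i]; rewrite negb_forall => /existsP[j].
  rewrite negb_imply negb_or !inE !negbK => /and3P[eij mi mj].
  exists (U_(i) + U_(j))%MM; split; first by exists i, j.
  have ij : i != j by apply: contraTneq eij => ->; rewrite e_irr.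
  apply/mnm_lepP => k; rewrite mnmDE !mnm1E.
  case: eqP => [<-|_]; last by case: eqP => [<-|_] //; rewrite lt0n.
  by rewrite eq_sym (negPf ij) lt0n.
move=> [_ [[i [j [eij ->]]] h]]; apply/indepP => hi; have := supp_sub_le h.
rewrite suppD => /subsetP hs.
have iS : i \in supp m by apply: hs; rewrite !inE !mnm1E eqxx.
have jS : j \in supp m by apply: hs; rewrite !inE !mnm1E eqxx orbT.
by have := hi i j iS jS; rewrite eij.
Qed.

Lemma prod_mesym1 C : \prod_(i in C) 'X_i = 'X_[mesym1 C] :> R.
Proof.
rewrite mpolyXE_id [RHS](bigID (mem C)) /= [X in _ * X]big1 ?mulr1.
  by apply: eq_bigr => i iC; rewrite mem_mesym1 iC.
by move=> i /negPf iC; rewrite mem_mesym1 iC.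
Qed.

Lemma cover_idealE f :
  cover_ideal K e f <-> mono (fun m => vertex_cover e (supp m)) f.
Proof.
apply: iff_trans (ideal_gen_mono
  (G := fun a => exists C, min_vertex_cover e C /\ a = mesym1 C) _ _) => [|m].
  apply: eq_ideal_gen => g; split=> [[C [hC ->]]|[_ [[C [hC ->]] ->]]].
    by exists (mesym1 C); rewrite prod_mesym1; split=> //; exists C.
  by exists C; rewrite prod_mesym1.
split=> [h|[_ [[C [/minsetp hC ->]]]]]; last by rewrite mesym1_le => /vertex_coverS; apply.
have [C hC sC] := minset_exists h.
by exists (mesym1 C); rewrite mesym1_le; split=> //; exists C.
Qed.

Lemma vertex_coverT : vertex_cover e [set: 'I_n].
Proof. by apply/vertex_coverP => i j _; rewrite inE. Qed.

Lemma alpha0_min C : vertex_cover e C -> (alpha0 e <= #|C|)%N.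
Proof. by rewrite /alpha0; case: arg_minnP => [|A _]; [exact: vertex_coverT|exact]. Qed.

Lemma alpha0_ex : exists C, vertex_cover e C /\ #|C| = alpha0 e.
Proof.
rewrite /alpha0; case: arg_minnP => [|A hA _]; first exact: vertex_coverT.
by exists A.
Qed.

Lemma alpha0_le : (alpha0 e <= n)%N.
Proof. by rewrite -[X in (_ <= X)%N](card_ord n) -cardsT alpha0_min ?vertex_coverT. Qed.

Lemma indep_card F : indep F -> (#|F| <= n - alpha0 e)%N.
Proof.
move=> /alpha0_min h; rewrite -(leq_add2r (alpha0 e)) subnK ?alpha0_le //.
by rewrite -[X in (_ <= X)%N](card_ord n) -(cardsC F) leq_add2l.
Qed.

Lemma alpha0_gt0 i j : e i j -> (0 < alpha0 e)%N.
Proof.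
have [C [/vertex_coverP hC <-]] := alpha0_ex; move=> /hC h.
by apply/card_gt0P; case/orP: h => h; [exists i|exists j].
Qed.

End GraphIdeals.

(** * The dimension bound *)

Lemma left_kernel_neq0 (K : fieldType) (p q : nat) (A : 'M[K]_(p, q)) :
  (q < p)%N -> exists2 u : 'rV[K]_p, u != 0 & u *m A = 0.
Proof.
move=> qp; have /rowV0Pn[u uk u0] : kermx A != 0.
  rewrite kermx_eq0 /row_free neq_ltn.
  by rewrite (leq_ltn_trans (rank_leq_col A) qp).
by exists u => //; apply/sub_kermxP.
Qed.

Section DimensionBound.

Variables (K : fieldType) (n : nat).
Local Notation R := {mpoly K[n]}.
Implicit Types (f g h : R) (I : nat -> R -> Prop).

Lemma idealZ (J : R -> Prop) c f : is_ideal J -> J f -> J (c *: f).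
Proof. by case=> _ _ JM Jf; rewrite -mul_mpolyC; apply: JM. Qed.

(* The products of powers of the [f k] are linearly independent modulo [I 0]:
   dividing a relation by a power of [f 0] and reducing modulo [I 1] leaves a
   relation between the remaining elements. *)
Lemma independent_products (E M d : nat) I (f : nat -> R) :
    (forall k, (k <= d)%N -> is_ideal (I k)) ->
    (forall k, (k < d)%N -> forall g, I k g -> I k.+1 g) ->
    (forall k, (k < d)%N -> I k.+1 (f k)) ->
    (forall k, (k < d)%N -> forall g, I k (f k * g) -> I k g) ->
    ~ I d 1 ->
    (forall k, (k < d)%N -> mono (fun m => mdeg m <= E)%N (f k)) ->
  exists (T : finType) (g : T -> R), [/\ #|T| = (M ^ d)%N,
    forall t, mono (fun m => mdeg m <= d * (M * E))%N (g t) &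
    forall c : T -> K, I 0%N (\sum_t c t *: g t) -> forall t, c t = 0].
Proof.
elim: d I f => [|d IH] I f idI incI fI nzd pI degf.
  exists unit, (fun=> 1); split; first by rewrite card_unit.
    by move=> t; apply: mono1; rewrite mdeg0.
  move=> c h [] //; apply/eqP; apply: contra_notT pI => c0.
  rewrite (big_pred1 tt) in h; last by case.
  have := idealZ (c tt)^-1 (idI 0%N isT) h.
  by rewrite scalerA mulVf // scale1r.
have [|||||| T [g [cT degg indg]]] := IH (fun k => I k.+1) (fun k => f k.+1); auto.
exists ('I_M * T)%type, (fun p : 'I_M * T => f 0%N ^+ p.1 * g p.2); split.
- by rewrite card_prod card_ord cT expnS.
- move=> [j t] /=; rewrite mulSn.
  apply: (mono2M (P := fun m => mdeg m <= M * E)%N) (degg t) => [a b ha hb|].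
    by rewrite mdegD leq_add.
  apply: (@sub_mono _ _ (fun m => mdeg m <= j * E)%N) => [m h|].
    by rewrite (leq_trans h) // leq_mul2r ltnW ?orbT.
  elim: (nat_of_ord j) => [|i IHi].
    by apply: mono1; rewrite mdeg0.
  rewrite exprS mulSn; apply: mono2M (degf 0%N isT) IHi => a b ha hb.
  by rewrite mdegD leq_add.
move=> c Ic.
pose G (j : 'I_M) := \sum_t c (j, t) *: g t.
have eG : \sum_(p : 'I_M * T) c p *: (f 0%N ^+ p.1 * g p.2) = \sum_(j < M) f 0%N ^+ j * G j.
  transitivity (\sum_(j < M) \sum_t c (j, t) *: (f 0%N ^+ j * g t)).
    by rewrite pair_bigA; apply: eq_bigr => -[j t].
  apply: eq_bigr => j _; rewrite mulr_sumr; apply: eq_bigr => t _.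
  by rewrite scalerAr.
rewrite {}eG in Ic.
suff main (k : nat) : forall j : 'I_M, (j < k)%N -> forall t, c (j, t) = 0.
  by move=> [j t]; apply: (main j.+1).
elim: k => // k IHk j; rewrite ltnS leq_eqVlt => /orP[/eqP jk|/IHk//].
have [H eH] : exists H, \sum_(i < M) f 0%N ^+ i * G i = f 0%N ^+ j * (G j + f 0%N * H).
  exists (\sum_(i < M | (j < i)%N) f 0%N ^+ (i - j.+1) * G i).
  rewrite (bigD1 j) //= mulrDr; congr (_ + _).
  rewrite (bigID (fun i : 'I_M => j < i)%N) /= [X in _ + X]big1 ?addr0.
    rewrite mulrA -exprSr mulr_sumr; apply: eq_big => [i|i /andP[_ ji]].
      by case: (ltnP j i) => ji; rewrite ?andbF // andbT -val_eqE /= gtn_eqF.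
    by rewrite mulrA -exprD subnKC.
  move=> i /andP[ij]; rewrite -leqNgt leq_eqVlt (inj_eq val_inj) (negPf ij) /=.
  move=> lij; rewrite /G big1 ?mulr0 // => t _.
  by rewrite IHk ?scale0r // -jk.
rewrite {}eH in Ic.
have {}Ic : I 0%N (G j + f 0%N * H).
  elim: (nat_of_ord j) Ic => [|i IHi]; first by rewrite mul1r.
  by rewrite exprS -mulrA => /(nzd 0%N isT)/IHi.
apply: (indg (fun t => c (j, t))); rewrite -/(G j).
have [_ _ I1M] := idI 1%N isT.
rewrite -(addrK (f 0%N * H) (G j)); apply: ideal_sub; first exact: idI.
  exact: incI.
by rewrite mulrC; apply: I1M; apply: fI.
Qed.

Variable e : rel 'I_n.
Hypothesis e_irr : irreflexive e.

Definition exps B (b : {ffun 'I_n -> 'I_B.+1}) : 'X_{1..n} :=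
  [multinom nat_of_ord (b i) | i < n].

(** A bound on the Hilbert function: there are at most [2 ^ n] supports, and an independent support
    has at most [n - alpha0 e] elements, which bounds the number of exponent vectors on it. *)
Lemma card_indep_exps B :
  (#|[set b : {ffun 'I_n -> 'I_B.+1} | indep e (supp (exps b))]|
     <= 2 ^ n * B.+1 ^ (n - alpha0 e))%N.
Proof.
rewrite -sum1_card (partition_big (fun b => supp (exps b)) (indep e)) /=; last first.
  by move=> b; rewrite inE.
apply: (@leq_trans (\sum_(S | indep e S) B.+1 ^ (n - alpha0 e))).
  apply: leq_sum => S indS; rewrite sum1_card.
  apply: (@leq_trans (B.+1 ^ #|S|)); last by rewrite leq_pexp2l ?indep_card.
  rewrite -[X in (_ <= X ^ _)%N]card_ord -[X in (_ <= X ^ _)%N]cardsT.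
  rewrite -(card_pffun_on ord0 (mem S)); apply/subset_leq_card/subsetP => b.
  rewrite inE => /andP[_ /eqP eS]; apply/pffun_onP; split=> [|i]; last by rewrite inE.
  by apply/subsetP => i; rewrite !inE -eS inE mnmE => ->.
rewrite sum_nat_const leq_mul2r; apply/orP; right.
rewrite (leq_trans (max_card _)) //.
by rewrite -cardsT -powersetT card_powerset cardsT card_ord.
Qed.

(** Covers prime chains and regular sequences together: both give ideals [I k] and elements [f k] of
    this kind. If [d] were larger than [n - alpha0 e], the [M ^ d] products from
    [independent_products] would outnumber the monomials outside the edge ideal in the same degrees,
    whose number grows only like [M ^ (n - alpha0 e)]. *)
Lemma dimension_bound (d : nat) I (f : nat -> R) :
    (forall k, (k <= d)%N -> is_ideal (I k)) ->
    (forall k, (k < d)%N -> forall g, I k g -> I k.+1 g) ->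
    (forall k, (k < d)%N -> I k.+1 (f k)) ->
    (forall k, (k < d)%N -> forall g, I k (f k * g) -> I k g) ->
    ~ I d 1 -> (forall g, edge_ideal K e g -> I 0%N g) ->
  (d <= n - alpha0 e)%N.
Proof.
move=> idI incI fI nzd pI eI; rewrite leqNgt; apply/negP => dlt.
pose E := (\max_(k < d) msize (f k))%N.
have degf k : (k < d)%N -> mono (fun m => mdeg m <= E)%N (f k).
  move=> kd m; rewrite -mcoeff_msupp => /msize_mdeg_lt/ltnW/leq_trans; apply.
  exact: (leq_bigmax (F := fun k : 'I_d => msize (f k)) (Ordinal kd)).
pose d0 := (n - alpha0 e)%N.
(* With [B = d * (M * E)] one has [B.+1 <= M * (d * E).+1], so there are at most
   [M ^ d0 * (2 ^ n * (d * E).+1 ^ d0)] monomials; this [M] makes that less than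
   [M ^ d0.+1 <= M ^ d]. *)
pose M := (2 ^ n * (d * E).+1 ^ d0).+1.
have [T [g [cT degg indg]]] := independent_products M idI incI fI nzd pI degf.
pose B := (d * (M * E))%N.
pose Y := [set b : {ffun 'I_n -> 'I_B.+1} | indep e (supp (exps b))].
have YT : (#|Y| < #|T|)%N.
  rewrite cT; apply: (leq_ltn_trans (card_indep_exps B)).
  apply: (@leq_ltn_trans (2 ^ n * (M * (d * E).+1) ^ d0)).
    have le_exp a b (k : nat) : (a <= b -> a ^ k <= b ^ k)%N.
      by move=> ab; elim: k => // k IHk; rewrite !expnS leq_mul.
    rewrite leq_mul2l le_exp ?orbT // /B.
    by rewrite mulnS mulnCA -addn1 addnC leq_add2r.
  rewrite expnMn mulnCA -/d0.
  apply: (@leq_trans (M ^ d0.+1)); last by rewrite leq_pexp2l.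
  by rewrite expnSr ltn_pmul2l ?expn_gt0.
pose A := \matrix_(t < #|T|, y < #|Y|) (g (enum_val t))@_(exps (enum_val y)).
(* The combination with coefficients [u] vanishes at every monomial outside the edge ideal, hence
   lies in that ideal, against independence modulo [I 0]. *)
have [u u0 uA] := left_kernel_neq0 A YT.
case/eqP: u0; apply/rowP => t; rewrite mxE -(enum_valK t).
apply: (indg (fun t => u 0 (enum_rank t))) => {t}; apply: eI.
apply/edge_idealE => // m; apply: contraNN => indm.
rewrite raddf_sum /=.
have [mB|mB] := leqP (mdeg m) B; last first.
  rewrite big1 // => t _; rewrite mcoeffZ; apply/eqP; rewrite mulf_eq0; apply/orP.
  right; apply: contraTT mB => /degg; by rewrite -leqNgt.
have mi i : (m i < B.+1)%N.
  by rewrite ltnS (leq_trans _ mB) // mdegE (bigD1 i) //= leq_addr.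
pose b := [ffun i => inord (m i) : 'I_B.+1].
have eb : exps b = m by apply/mnmP => i; rewrite mnmE ffunE inordK.
have bY : b \in Y by rewrite inE eb.
have /rowP/(_ (enum_rank_in bY b)) := uA; rewrite !mxE => uAb.
rewrite -[X in _ == X]uAb (reindex (@enum_val T predT)) /=; last first.
  by apply: onW_bij; exists enum_rank; [exact: enum_valK|exact: enum_rankK].
by apply/eqP; apply: eq_bigr => t _; rewrite mcoeffZ enum_valK mxE enum_rankK_in // eb.
Qed.

End DimensionBound.

(** * Krull dimension and regular sequences *)

Section Faces.

Variables (K : fieldType) (n : nat).
Local Notation R := {mpoly K[n]}.
Implicit Types (f g h : R) (P : pred 'X_{1..n}).

(** Under these conditions [mpart P] is multiplicative, and the ideal is its kernel; primality
    follows since the polynomial ring is a domain. *)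
Lemma mono_face_prime P :
    P 0%MM -> (forall a b, P (a + b)%MM = P a && P b) ->
  is_prime (mono (K := K) (predC P)).
Proof.
move=> P0 PD; have id : is_ideal (mono (K := K) (predC P)).
  by apply: mono_ideal => a b /= nPb; rewrite PD (negPf nPb) andbF.
have partP f : mono (predC P) f <-> mpart P f = 0.
  split=> h; first apply/mpolyP => m; last move=> m.
    rewrite mcoeff_mpart mcoeff0; case: ifP => // Pm.
    by apply/eqP; apply: contraTT Pm => /h.
  apply: contraNN => Pm; have /(congr1 (mcoeff m)) := h.
  by rewrite mcoeff_mpart Pm mcoeff0 => ->.
have dec f : mono (predC P) (f - mpart P f).
  move=> m; rewrite mcoeffB mcoeff_mpart /=.
  by case: ifP => //; rewrite subrr eqxx.
have [I0 ID IM] := id.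
split=> [//| |f g]; first by rewrite -mpolyX0 => /monoXm; rewrite /= P0.
have partM : mpart P (f * g) = mpart P f * mpart P g.
  have -> : f * g = mpart P f * mpart P g +
      (mpart P f * (g - mpart P g) + g * (f - mpart P f)) by ring.
  rewrite linearD /= [X in _ + X](_ : _ = 0); last first.
    by apply/partP; apply: ID; apply: IM; apply: dec.
  rewrite addr0 mpart_mono //; apply: (mono2M _ (@mono_mpart _ _ P f) (@mono_mpart _ _ P g)).
  by move=> a b Pa Pb; rewrite PD Pa.
move=> /partP; rewrite partM => /eqP; rewrite mulf_eq0.
by case/orP=> /eqP/partP; [left|right].
Qed.

Definition var_ideal (A : {set 'I_n}) : R -> Prop :=
  mono (predC (fun m => [disjoint A & supp m])).

Lemma var_ideal_prime A : is_prime (var_ideal A).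
Proof.
apply: mono_face_prime => [|a b].
  by apply/pred0P => i /=; rewrite inE mnm0E andbF.
by rewrite suppD -!setI_eq0 setIUr setU_eq0.
Qed.

Lemma var_idealX A i : var_ideal A 'X_i <-> i \in A.
Proof.
apply: (iff_trans (monoXm K _ _)) => /=.
have -> : supp U_(i) = [set i].
  by apply/setP => j; rewrite inE in_set1 mnm1E [j == i]eq_sym; case: (i == j).
by rewrite disjoint_sym disjoints1 negbK; split.
Qed.

End Faces.

Section CohenMacaulay.

Variables (K : fieldType) (n : nat) (e : rel 'I_n).
Hypothesis e_irr : irreflexive e.
Local Notation R := {mpoly K[n]}.
Local Notation I := (edge_ideal K e).
Local Notation d := (n - alpha0 e)%N.

(** For the upper bound, an element of [P k.+1] outside [P k] is a nonzerodivisor modulo the prime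
    [P k], so [dimension_bound] applies. *)
Lemma edge_ideal_krull_dim : is_krull_dim I d.
Proof.
split; last first.
  move=> c [P [hP incP]].
  have /choice_fun[f hf] : forall k, exists f, (k < c)%N -> P k.+1 f /\ ~ P k f.
    move=> k; have [kc|] := ltnP k c; last by exists 0.
    by have [_ [f hf]] := incP k kc; exists f.
  apply: (@dimension_bound K n e e_irr c P f) => [k /hP[[]]|k /incP[]||k kc g||g] //.
  - by move=> k /hf[].
  - have [[_ _ prP] _] := hP k (ltnW kc).
    by case/prP=> // hk; case: (hf k kc).
  - by have [[]] := hP c (leqnn c).
  - by have [_] := hP 0%N isT; apply.
have [C [hC cC]] := alpha0_ex e.
pose l := enum (~: C).
have sl : size l = d by rewrite -cardE cardsCs setCK cC card_ord.
(* The chain starts at the prime generated by a smallest vertex cover and adds the remaining [d]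
   variables one at a time. *)
exists (fun k => var_ideal (C :|: [set i in take k l])); split=> k kd.
  split=> [|f]; first exact: var_ideal_prime.
  move/(edge_idealE _ e_irr); apply: sub_mono => m /=; apply: contraNN => dis.
  apply: vertex_coverS hC; rewrite -disjoints_subset.
  by apply: disjointWl dis; apply: subsetUl.
have [x0 _] : exists x0, x0 \in l.
  by case: (l) (sl) kd => [<-//|x s _ _]; exists x; rewrite mem_head.
rewrite (take_nth x0) ?sl //; split=> [f|].
  apply: sub_mono => m /=; apply: contraNN; apply: disjointWl; apply: setUS.
  by apply/subsetP => i; rewrite !inE mem_rcons inE orbC => ->.
exists 'X_(nth x0 l k); split.
  by apply/var_idealX; rewrite !inE mem_rcons mem_head orbT.
move/var_idealX; rewrite !inE => /orP[iC|].
  by have := mem_nth x0 (s := l) (n := k); rewrite sl mem_enum inE iC => /(_ kd).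
apply/negP; have : uniq (take k l ++ drop k l) by rewrite cat_take_drop enum_uniq.
rewrite (drop_nth x0) ?sl // cat_uniq => /and3P[_ /hasPn h _].
by apply: h; rewrite mem_head.
Qed.

Lemma regular_seq_bound s : regular_seq I s -> (size s <= d)%N.
Proof.
case=> pI nzd; pose J k := ideal_plus I (take k s).
apply: (@dimension_bound K n e e_irr (size s) J (nth 0 s)) => [k _|k ks g|k ks|k ks g||g hg].
- exact: ideal_gen_is_ideal.
- apply: ideal_gen_min; first exact: ideal_gen_is_ideal.
  move=> h [Ih|hs]; apply: ideal_gen_sub; [by left|right].
  by rewrite (take_nth 0) // mem_rcons inE hs orbT.
- by apply: ideal_gen_sub; right; rewrite (take_nth 0) // mem_rcons mem_head.
- exact: nzd.
- by rewrite /J take_size.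
- by apply: ideal_gen_sub; left.
Qed.

Lemma cohen_macaulay_edgeP : cohen_macaulay I <->
  exists s, [/\ size s = d, forall f, f \in s -> irrelevant f & regular_seq I s].
Proof.
split=> [[c [[hs _] dimc]]|hs].
  by rewrite (is_max_unique edge_ideal_krull_dim dimc).
exists d; split; last exact: edge_ideal_krull_dim.
by split=> // r [s [<- _ /regular_seq_bound]].
Qed.

End CohenMacaulay.

(** * Koszul operators *)

Section Signs.

Variables (n : nat) (V : zmodType).
Implicit Types (S : {set 'I_n}) (j k : 'I_n) (b : bool) (v : V).

Definition sv b v : V := if b then - v else v.

Lemma svB b : {morph sv b : u v / u - v}.
Proof. by case: b => u v //=; rewrite opprD. Qed.

Lemma svD b : {morph sv b : u v / u + v}.
Proof. by case: b => u v //=; rewrite opprD. Qed.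

Lemma sv0 b : sv b 0 = 0.
Proof. by case: b; rewrite //= oppr0. Qed.

Lemma svK b : involutive (sv b).
Proof. by case: b => v //=; rewrite opprK. Qed.

Lemma sv_sv b b' v : sv b (sv b' v) = sv (b (+) b') v.
Proof. by case: b; case: b'; rewrite //= opprK. Qed.

Lemma sv_sum b (I : Type) (r : seq I) (P : pred I) (F : I -> V) :
  sv b (\sum_(i <- r | P i) F i) = \sum_(i <- r | P i) sv b (F i).
Proof. by case: b => //=; rewrite sumrN. Qed.

(** The sign of moving the basis vector of [k] to its place in the ordered exterior product over
    [S]. *)
Definition sb k S : bool := odd #|[set j in S | (j < k)%N]|.

Lemma sbU1 j k S : j \notin S -> sb k (j |: S) = (j < k)%N (+) sb k S.
Proof.
move=> jS; rewrite /sb; case jk: (j < k)%N.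
  have -> : [set i in j |: S | (i < k)%N] = j |: [set i in S | (i < k)%N].
    apply/setP => i; rewrite !inE; case: eqP => [->|//]; rewrite /= jk.
    by [].
  by rewrite cardsU1 inE (negPf jS) /=.
congr odd; apply: eq_card => i; rewrite !inE.
by case: eqP => [->|//]; rewrite jk !andbF.
Qed.

Lemma sbD1 j k S : j \in S -> sb k (S :\ j) = (j < k)%N (+) sb k S.
Proof.
move=> jS; rewrite -[in RHS](setD1K jS) sbU1 ?setD11 //.
by rewrite addbA addbb.
Qed.

Lemma ltn_addb j k : j != k -> (j < k)%N (+) (k < j)%N.
Proof. by rewrite -val_eqE /=; case: ltngtP. Qed.

(** Terms with [j < k] are matched with those with [k < j]; comparing the sum with its own negative
    would fail in characteristic 2. *)
Lemma antisym_sum (P : pred 'I_n) (F : 'I_n -> 'I_n -> V) :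
    (forall j k, P j -> P k -> j != k -> F j k = - F k j) ->
  \sum_(k | P k) \sum_(j | P j && (j != k)) F k j = 0.
Proof.
move=> anti.
under eq_bigr => k _ do rewrite (bigID (fun j : 'I_n => (j < k)%N)) /=.
rewrite big_split /= [X in _ + X](exchange_big_dep P) /=; last by move=> ? ? _ /andP[/andP[]].
rewrite -big_split big1 //= => k Pk; rewrite addrC.
apply/eqP; rewrite addr_eq0 -sumrN; apply/eqP; apply: eq_big => j.
  rewrite Pk /= -leqNgt; case: (P j) => //=.
  by rewrite -!val_eqE /=; case: ltngtP.
by case/andP=> Pj /andP[/andP[_ kj] _]; rewrite anti // eq_sym.
Qed.

End Signs.

Section Koszul.

Variables (A : comNzRingType) (V : lmodType A) (n : nat).
Implicit Types (c : {set 'I_n} -> V) (S : {set 'I_n}) (j k : 'I_n) (y : 'I_n -> A).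

(** Koszul differentials on functions of all subsets; a chain of degree [q] is such a function read
    on sets of size [q]. [cod] is exterior multiplication by the vector [y] and raises the size,
    [dl] is contraction with [y] and lowers it. *)
Definition cod y c S : V :=
  \sum_(k in S) sv (sb k (S :\ k)) (y k *: c (S :\ k)).

Definition dl y c S : V :=
  \sum_(k | k \notin S) sv (sb k S) (y k *: c (k |: S)).

Lemma eq_cod y c c' S :
  (forall k, k \in S -> c (S :\ k) = c' (S :\ k)) -> cod y c S = cod y c' S.
Proof. by move=> h; apply: eq_bigr => k /h ->. Qed.

Lemma eq_dl y c c' S :
  (forall k, k \notin S -> c (k |: S) = c' (k |: S)) -> dl y c S = dl y c' S.
Proof. by move=> h; apply: eq_bigr => k /h ->. Qed.

Lemma codB y c c' S : cod y (fun T => c T - c' T) S = cod y c S - cod y c' S.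
Proof.
by rewrite /cod -sumrB; apply: eq_bigr => k _; rewrite scalerBr svB.
Qed.

Lemma dlB y c c' S : dl y (fun T => c T - c' T) S = dl y c S - dl y c' S.
Proof.
by rewrite /dl -sumrB; apply: eq_bigr => k _; rewrite scalerBr svB.
Qed.

Lemma svZ b (a : A) (v : V) : sv b (a *: v) = a *: sv b v.
Proof. by case: b; rewrite //= scalerN. Qed.

Lemma codZ y (a : A) c S : cod y (fun T => a *: c T) S = a *: cod y c S.
Proof.
by rewrite /cod scaler_sumr; apply: eq_bigr => k _; rewrite -svZ !scalerA mulrC.
Qed.

Lemma cod_linear (V' : lmodType A) (phi : {linear V -> V'}) y c S :
  phi (cod y c S) =
  \sum_(k in S) sv (sb k (S :\ k)) (y k *: phi (c (S :\ k))).
Proof.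
rewrite linear_sum; apply: eq_bigr => k _.
by rewrite -linearZ /=; case: sb; rewrite //= linearN.
Qed.

Lemma cod_cod y c S : cod y (cod y c) S = 0.
Proof.
rewrite /cod -[RHS](@antisym_sum n _ (fun j => j \in S) (fun k j =>
  sv (sb k (S :\ k) (+) sb j (S :\ k :\ j)) ((y k * y j) *: c (S :\ k :\ j)))).
  apply: eq_bigr => k kS; rewrite scaler_sumr sv_sum.
  apply: eq_big => [j|j _]; first by rewrite !inE andbC.
  by rewrite -svZ sv_sv scalerA.
move=> j k jS kS jk.
have kS' : k \in S :\ j by rewrite !inE eq_sym jk.
have jS' : j \in S :\ k by rewrite !inE jk.
have -> : S :\ k :\ j = S :\ j :\ k by rewrite !setDDl setUC.
have -> : sb j (S :\ j) (+) sb k (S :\ j :\ k) =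
   ~~ (sb k (S :\ k) (+) sb j (S :\ j :\ k)).
  rewrite [sb k (S :\ j :\ k)](sbD1 _ kS') [sb j (S :\ j :\ k)](sbD1 _ kS').
  rewrite ltnn [sb k (S :\ j)](sbD1 _ jS) [sb k (S :\ k)](sbD1 _ kS) ltnn.
  have := ltn_addb jk.
  by case: (j < k)%N; case: (k < j)%N; case: (sb k S); case: (sb j _).
by rewrite mulrC; case: (_ (+) _); rewrite /= ?opprK.
Qed.

Lemma dl_dl y c S : dl y (dl y c) S = 0.
Proof.
rewrite /dl -[RHS](@antisym_sum n _ (fun j => j \notin S) (fun k j =>
  sv (sb k S (+) sb j (k |: S)) ((y k * y j) *: c (j |: (k |: S))))).
  apply: eq_bigr => k kS; rewrite scaler_sumr sv_sum.
  apply: eq_big => [j|j _]; first by rewrite !inE negb_or andbC.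
  by rewrite -svZ sv_sv scalerA.
move=> j k jS kS jk; rewrite /= in jS kS.
have -> : k |: (j |: S) = j |: (k |: S) by rewrite setUCA.
rewrite !sbU1 //; have := ltn_addb jk.
by rewrite mulrC; case: (j < k)%N; case: (k < j)%N; case: (sb k S);
  case: (sb j S); rewrite //= ?opprK.
Qed.

(** Contraction with the [j]-th basis vector, and below it exterior multiplication: the homotopies
    through which [y j] acts as zero on the homology of [cod] and of [dl]. *)
Definition annih j c S : V := if j \in S then 0 else sv (sb j S) (c (j |: S)).

Definition create j c S : V :=
  if j \in S then sv (sb j (S :\ j)) (c (S :\ j)) else 0.

Lemma cod_annih y j c S : cod y (annih j c) S + annih j (cod y c) S = y j *: c S.
Proof.
rewrite {2}/annih; case: ifPn => jS.
  rewrite addr0 /cod (bigD1 j) //= big1 ?addr0.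
    by rewrite /annih setD11 setD1K // -svZ sv_sv addbb.
  by move=> k /andP[kS kj]; rewrite /annih !inE eq_sym kj jS scaler0 sv0.
rewrite /cod [X in _ + sv _ X](bigD1 j) ?setU11 //= svD setU1K // sv_sv addbb /=.
rewrite addrCA -[RHS]addr0; congr (_ + _).
rewrite sv_sum [X in _ + X](eq_bigl (fun k => k \in S)); last first.
  by move=> k; rewrite !inE; case: eqP => [->|]; rewrite ?andbT // (negPf jS).
rewrite -big_split big1 //= => k kS.
have kj : k != j by apply: contraTneq kS => ->.
have jSk : j \notin S :\ k by rewrite !inE (negPf jS) andbF.
rewrite /annih (negPf jSk) -svZ.
have -> : j |: (S :\ k) = (j |: S) :\ k.
  apply/setP => i; rewrite !inE; case: eqP => [->|] //=.
  by rewrite eq_sym kj.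
rewrite svZ !svZ !sv_sv -!svZ.
rewrite (sbD1 _ kS) ltnn (sbD1 _ kS) [sb k (_ :\ k)](@sbD1 _ k) ?inE ?kS ?orbT //.
rewrite ltnn sbU1 //; have := ltn_addb kj.
case: (j < k)%N; case: (k < j)%N; case: (sb k S);
  case: (sb j S); rewrite //= ?opprK ?scalerN ?addNr ?addrN //.
Qed.

Lemma dl_create y j c S : dl y (create j c) S + create j (dl y c) S = y j *: c S.
Proof.
rewrite {2}/create; case: ifPn => jS; last first.
  rewrite addr0 /dl (bigD1 j) //= big1 ?addr0.
    by rewrite /create setU11 setU1K // -svZ sv_sv addbb.
  by move=> k /andP[kS kj]; rewrite /create !inE eq_sym (negPf kj) (negPf jS) scaler0 sv0.
rewrite /dl [X in _ + sv _ X](bigD1 j) ?setD11 //= svD setD1K // sv_sv addbb /=.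
rewrite addrCA -[RHS]addr0; congr (_ + _).
rewrite sv_sum [X in _ + X](eq_bigl (fun k => k \notin S)); last first.
  move=> k; rewrite !inE negb_and negbK; case: eqP => [->|]; rewrite ?andbT ?andbF ?jS //.
rewrite -big_split big1 //= => k kS.
have kj : k != j by apply: contraNneq kS => ->.
rewrite /create !inE jS orbT.
have eS : (k |: S) :\ j = k |: (S :\ j).
  apply/setP => i; rewrite !inE; case: eqP => [->|] //=.
  by rewrite eq_sym (negPf kj).
rewrite eS !svZ !sv_sv -!svZ sbU1 ?inE ?(negPf kS) ?andbF //.
rewrite (sbD1 _ jS) (sbD1 _ jS) ltnn; have := ltn_addb kj.
case: (j < k)%N; case: (k < j)%N; case: (sb k S);
  case: (sb j S); rewrite //= ?opprK ?scalerN ?addNr ?addrN //.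
Qed.

End Koszul.

(** * Regular sequences on modules *)

Section RegularSequences.

Variable A : comNzRingType.

Definition submod (V : lmodType A) (L : V -> Prop) : Prop :=
  [/\ L 0, forall u v, L u -> L v -> L (u + v) & forall a v, L v -> L (a *: v)].

(** The submodule [L + a V]. Quotient modules are never formed: a module is an ambient [V] with its
    relations [L], and reducing modulo [a] enlarges [L]. *)
Definition addm (V : lmodType A) (L : V -> Prop) (a : A) : V -> Prop :=
  fun v => exists w, L (v - a *: w).

Definition nzd (V : lmodType A) (L : V -> Prop) (a : A) : Prop :=
  forall v, L (a *: v) -> L v.

(* [s] is a weakly regular sequence on the quotient of [V] by [L]. *)
Fixpoint reg (V : lmodType A) (L : V -> Prop) (s : seq A) : Prop :=
  if s is a :: s' then nzd L a /\ reg (addm L a) s' else True.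

Section OneModule.

Variable V : lmodType A.
Implicit Types (L : V -> Prop) (u v w : V) (a : A) (s : seq A).

Lemma submodN L v : submod L -> L v -> L (- v).
Proof. by case=> _ _ LZ Lv; rewrite -scaleN1r; apply: LZ. Qed.

Lemma submodB L u v : submod L -> L u -> L v -> L (u - v).
Proof.
by move=> sL Lu Lv; case: (sL) => _ LD _; apply: LD => //; apply: submodN.
Qed.

Lemma submod_sum L (I : Type) (r : seq I) (P : pred I) (F : I -> V) :
  submod L -> (forall i, P i -> L (F i)) -> L (\sum_(i <- r | P i) F i).
Proof. by case=> L0 LD _ h; elim/big_ind: _. Qed.

Lemma submod_sv L b v : submod L -> L v -> L (sv b v).
Proof. by case: b => //= sL; apply: submodN. Qed.

Lemma submod_addm L a : submod L -> submod (addm L a).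
Proof.
move=> sL; case: (sL) => L0 LD LZ; split=> [|u v [w hw] [x hx]|b v [w hw]].
- by exists 0; rewrite scaler0 subr0.
- by exists (w + x); rewrite scalerDr opprD addrACA; apply: LD.
- by exists (b *: w); rewrite scalerA mulrC -scalerA -scalerBr; apply: LZ.
Qed.

Lemma addm_sub L a v : L v -> addm L a v.
Proof. by move=> Lv; exists 0; rewrite scaler0 subr0. Qed.

Lemma eq_addm L L' a v : (forall v, L v <-> L' v) -> addm L a v <-> addm L' a v.
Proof. by move=> h; split=> -[w /h]; exists w. Qed.

Lemma addm_swap L a b v : addm (addm L a) b v -> addm (addm L b) a v.
Proof. by case=> w [w' h]; exists w', w; rewrite addrAC. Qed.

Lemma eq_nzd L L' a : (forall v, L v <-> L' v) -> nzd L a -> nzd L' a.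
Proof. by move=> h z v /h/z/h. Qed.

Lemma eq_reg L L' s : (forall v, L v <-> L' v) -> reg L s -> reg L' s.
Proof.
elim: s L L' => //= a s IH L L' h [z r]; split; first exact: eq_nzd z.
by apply: IH r => v; apply: eq_addm.
Qed.

Lemma submod_addms L s : submod L -> submod (foldl (@addm V) L s).
Proof. by elim: s L => //= a s IH L /(submod_addm a)/IH. Qed.

Lemma addms_sub L s v : L v -> foldl (@addm V) L s v.
Proof. by elim: s L => //= a s IH L /(addm_sub a)/IH. Qed.

Lemma reg_rcons L s a :
  reg L (rcons s a) <-> reg L s /\ nzd (foldl (@addm V) L s) a.
Proof.
elim: s L => [|b s IH] L /=; first by split=> [[]|[]].
split=> [[zb /IH[rs za]]|[[zb rs] za]] //; split=> //; exact/IH.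
Qed.

Lemma nzd_prod L (I : Type) (r : seq I) (P : pred I) (a : I -> A) :
  (forall i, P i -> nzd L (a i)) -> nzd L (\prod_(i <- r | P i) a i).
Proof.
move=> h; elim/big_ind: _ => // [v|b c zb zc v]; first by rewrite scale1r.
by rewrite -scalerA => /zb/zc.
Qed.

End OneModule.

(** The depth lemma for the short exact sequence of [V / L], [V' / L'] and its cokernel [V' / L''].
    Regularity of the first element on the submodule is inherited from the middle term; the sequence
    stays exact modulo that element when it is a nonzerodivisor on the cokernel, which only matters
    if further elements follow. *)
Lemma reg_depth (V V' : lmodType A) (phi : {linear V -> V'}) (L : V -> Prop)
    (L' L'' : V' -> Prop) (s : seq A) :
    submod L' -> (forall f, L f <-> L' (phi f)) ->
    (forall g, L'' g <-> exists f, L' (g - phi f)) ->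
  reg L' s -> reg L'' (take (size s).-1 s) -> reg L s.
Proof.
elim: s L L' L'' => //= a s IH L L' L'' sL' LE LE'' [za rs] rs''.
split=> [f /LE|]; first by rewrite linearZ => /za/LE.
case: s IH rs rs'' => // b s IH rs [za'' rs''].
apply: IH rs rs'' => [|f|g]; first exact: submod_addm.
  split=> [[w /LE h]|[w h]].
    by exists (phi w); rewrite linearB linearZ in h.
  have /za''/LE''[f' hf'] : L'' (a *: w).
    by apply/LE''; exists f; rewrite -opprB; apply: submodN.
  exists f'; apply/LE; rewrite linearB linearZ /=.
  case: sL' => _ LD LZ; have := LD _ _ h (LZ a _ hf').
  by rewrite scalerBr addrA subrK.
split=> [[w /LE''[f hf]]|[f [w hf]]].
  by exists f, w; rewrite addrAC.
by exists w; apply/LE''; exists f; rewrite addrAC.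
Qed.

Lemma reg_family (X Y : finType) (V : lmodType A) (Q : pred Y)
    (L : Y -> {ffun X -> V} -> Prop) (s : seq A) :
    (forall y, Q y -> reg (L y) s) ->
  reg (fun g : {ffun Y * X -> V} => forall y, Q y -> L y [ffun x => g (y, x)]) s.
Proof.
elim: s L => //= a s IH L h; split=> [g hg y Qy|].
  have [za _] := h y Qy; apply: za.
  by have := hg y Qy; congr (L y _); apply/ffunP => x; rewrite !ffunE.
have {}IH := IH (fun y => addm (L y) a) (fun y Qy => proj2 (h y Qy)).
apply: eq_reg IH => g; split=> [hg|[w hw] y Qy].
  have /choice_ffun[w hw] : forall y, exists w, Q y ->
      L y ([ffun x => g (y, x)] - a *: w).
    move=> y; have [/hg[w hw]|_] := boolP (Q y); [by exists w|by exists 0].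
  exists [ffun p => w p.1 p.2] => y Qy; have := hw y Qy.
  by congr (L y _); apply/ffunP => x; rewrite !ffunE.
exists [ffun x => w (y, x)]; have := hw y Qy.
by congr (L y _); apply/ffunP => x; rewrite !ffunE.
Qed.

End RegularSequences.

(** * Graded pieces and permutation of homogeneous regular sequences *)

Section Homogeneous.

Variables (K : fieldType) (n : nat).
Local Notation R := {mpoly K[n]}.

Lemma mpart_mul (P Q T : pred 'X_{1..n}) (a f : R) :
    mono P a -> (forall b c, P b -> T (b + c)%MM = Q c) ->
  mpart T (a * f) = a * mpart Q f.
Proof.
move=> Pa PTQ; rewrite -{1}(subrKC (mpart Q f) f) mulrDr linearD /=.
rewrite mpart_mono; last by apply: (mono2M _ Pa (@mono_mpart _ _ Q f)) => b c /PTQ ->; exact.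
have : mono (predC T) (a * (f - mpart Q f)).
  apply: (mono2M _ Pa (Q := predC Q)) => [b c /PTQ /= ->|m /=] //.
  by rewrite mcoeffB mcoeff_mpart; case: ifP => //; rewrite subrr eqxx.
move=> h; rewrite [X in _ + X](_ : _ = 0) ?addr0 //.
apply/mpolyP => m; rewrite mcoeff_mpart mcoeff0; case: ifP => // Tm.
by apply/eqP; apply: contraTT Tm => /h.
Qed.

(* The component of degree [d] when the generator sits in degree [s]. *)
Definition hc (d s : nat) : R -> R := mpart (fun m => mdeg m + s == d)%N.
HB.instance Definition _ d s := GRing.Linear.on (hc d s).

Lemma mcoeff_hc d s f m : (hc d s f)@_m = if (mdeg m + s == d)%N then f@_m else 0.
Proof. exact: mcoeff_mpart. Qed.

Lemma hc_mul d s k (a f : R) :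
  mono (fun m => mdeg m == k) a -> hc d s (a * f) = a * hc d (k + s) f.
Proof.
by move=> ha; apply: (mpart_mul _ ha) => b c /eqP <-; rewrite mdegD addnCA addnA.
Qed.

Variable X : finType.
Local Notation V := {ffun X -> R^o}.
Implicit Types (L : V -> Prop) (v : V).

Definition hcv (d s : nat) v : V := [ffun x => hc d s (v x)].

Definition homogm L := forall d v, L v -> L (hcv d 0 v).

Lemma hcv_scale d s k (a : R) v :
  mono (fun m => mdeg m == k) a -> hcv d s (a *: v) = a *: hcv d (k + s) v.
Proof. by move=> ha; apply/ffunP => x; rewrite !ffunE; apply: hc_mul ha. Qed.

Lemma hcv_scaleD d s k (a : R) v :
  mono (fun m => mdeg m == k) a -> hcv (k + d) s (a *: v) = a *: hcv d s v.
Proof.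
move=> ha; rewrite (hcv_scale _ _ _ ha); apply/ffunP => x; rewrite !ffunE.
congr (_ * _); apply/mpolyP => m.
by rewrite !mcoeff_hc addnCA eqn_add2l.
Qed.

Lemma hcvB d s u v : hcv d s (u - v) = hcv d s u - hcv d s v.
Proof. by apply/ffunP => x; rewrite !ffunE linearB. Qed.

Lemma hcv_id d v : hcv d 0 (hcv d 0 v) = hcv d 0 v.
Proof.
apply/ffunP => x; rewrite !ffunE; apply/mpolyP => m.
by rewrite !mcoeff_hc; case: (_ == d).
Qed.

Lemma sum_hcv v : exists N, v = \sum_(d < N) hcv d 0 v.
Proof.
pose N := (\max_x msize (v x))%N; exists N; apply/ffunP => x; rewrite sum_ffunE.
apply/mpolyP => m; rewrite raddf_sum /=.
under eq_bigr => d _ do rewrite ffunE mcoeff_hc addn0.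
have [mN|Nm] := ltnP (mdeg m) N.
  rewrite (bigD1 (Ordinal mN)) //= eqxx big1 ?addr0 // => d.
  by rewrite -val_eqE /= eq_sym => /negPf ->.
rewrite big1 => [|d _]; last by rewrite gtn_eqF // (leq_trans _ Nm).
apply: memN_msupp_eq0; apply: msize_mdeg_ge; apply: leq_trans Nm.
exact: leq_bigmax.
Qed.

Lemma homogm_addm L (a : R) k :
  homogm L -> mono (fun m => mdeg m == k) a -> homogm (addm L a).
Proof.
move=> hL ha d v [w /(hL d)]; rewrite hcvB (hcv_scale _ _ _ ha) addn0.
by move=> h; exists (hcv d k w).
Qed.

(* Graded Nakayama: an element killed by [a] modulo [L] is divisible by [x],
   and the quotient is again killed, in one degree less. *)
Lemma nzd_lift L (x a : R) k :
    submod L -> homogm L ->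
    mono (fun m => mdeg m == 1)%N x -> mono (fun m => mdeg m == k) a ->
  nzd L x -> nzd (addm L x) a -> nzd L a.
Proof.
move=> sL hL hx ha zx za.
have key D u : L (a *: u) -> L (hcv D 0 u).
  elim: D u => [|D IH] u Lau; have [u' hu'] : addm L x u by
      apply: za; apply: addm_sub.
    have := hL 0%N _ hu'; rewrite hcvB (hcv_scale _ _ _ hx).
    rewrite [hcv 0 (1 + 0) u'](_ : _ = 0) ?scaler0 ?subr0 //.
    by apply/ffunP => y; rewrite !ffunE; apply/mpolyP => m; rewrite mcoeff_hc addn1 mcoeff0.
  have := hL (1 + D)%N _ hu'; rewrite hcvB (hcv_scaleD _ _ _ hx).
  set u1 := hcv D 0 u' => h1.
  have Lau1 : L (a *: hcv D.+1 0 u) by rewrite -(hcv_scaleD _ _ _ ha); apply: hL.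
  have : L (x *: (a *: u1)).
    case: (sL) => _ _ LZ; have := submodB sL Lau1 (LZ a _ h1).
    by rewrite scalerBr opprB addrC subrK !scalerA mulrC.
  move=> /zx/IH; rewrite /u1 hcv_id -/u1 => Lu1.
  case: (sL) => _ LD LZ; have := LD _ _ h1 (LZ x _ Lu1); by rewrite subrK.
move=> u Lau; have [N ->] := sum_hcv u.
by apply: submod_sum => // d _; apply: key.
Qed.

(** Moves a linear form from the front of a homogeneous regular sequence to its end, past one
    element at a time; [nzd_lift] supplies the nontrivial half of each exchange. *)
Lemma reg_swap L (x : R) (s : seq R) :
    submod L -> homogm L -> mono (fun m => mdeg m == 1)%N x ->
    (forall a, a \in s -> exists k, mono (fun m => mdeg m == k) a) ->
    nzd L x -> reg (addm L x) s ->
  reg L s /\ nzd (foldl (@addm _ V) L s) x.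
Proof.
move=> sL hL hx; elim: s L sL hL => [|a s IH] L sL hL hs zx; first by move=> _; split.
case=> zxa rs.
have [k ha] := hs a (mem_head _ _).
have za : nzd L a by exact: nzd_lift hx ha zx zxa.
have hs' b : b \in s -> exists k, mono (fun m => mdeg m == k) b.
  by move=> bs; apply: hs; rewrite inE bs orbT.
have zx' : nzd (addm L a) x.
  move=> v [w h].
  have /zxa[w' hw'] : addm L x (a *: w).
    by exists v; rewrite -opprB; apply: submodN.
  exists w'; apply: zx; rewrite scalerBr.
  case: (sL) => _ LD LZ; have := LD _ _ h (LZ a _ hw').
  by rewrite scalerBr addrA subrK !scalerA mulrC.
have rs' : reg (addm (addm L a) x) s.
  by apply: eq_reg rs => v; split; apply: addm_swap.
have [r z] := IH _ (submod_addm _ sL) (homogm_addm hL ha) hs' zx' rs'.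
by split=> //; split.
Qed.

End Homogeneous.

(** * Squarefree modules *)

Section SquarefreeModules.

Variables (K : fieldType) (n : nat).
Local Notation R := {mpoly K[n]}.
Implicit Types (F G S T : {set 'I_n}) (m : 'X_{1..n}) (X : finType).

Definition coefv X (m : 'X_{1..n}) (f : {ffun X -> R^o}) : {ffun X -> K^o} :=
  [ffun x => (f x : R)@_m].

Fact coefv_is_additive X m : additive (@coefv X m).
Proof. by move=> f g; apply/ffunP => x; rewrite !ffunE; apply: raddfB. Qed.
HB.instance Definition _ X m :=
  GRing.isAdditive.Build _ _ (@coefv X m) (coefv_is_additive m).

Lemma coefvB X m (f g : {ffun X -> R^o}) :
  coefv m (f - g) = coefv m f - coefv m g.
Proof. exact: raddfB. Qed.

(* A squarefree module generated in degree 0: in degrees with support [F] its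
   component is [K^X] modulo [N F]. *)
Definition squarefree X (N : {set 'I_n} -> {ffun X -> K^o} -> Prop) : Prop :=
  (forall F, submod (N F)) /\ forall F G u, F \subset G -> N F u -> N G u.

Definition sqrel X (N : {set 'I_n} -> {ffun X -> K^o} -> Prop)
  (f : {ffun X -> R^o}) : Prop := forall m, N (supp m) (coefv m f).

Lemma coefv_scaleX X (b m : 'X_{1..n}) (f : {ffun X -> R^o}) :
  coefv m (('X_[b] : R) *: f) = if (b <= m)%MM then coefv (m - b) f else 0.
Proof.
by apply/ffunP => x; case: ifP => h; rewrite !ffunE [LHS]mcoeffXM h.
Qed.

Lemma coefv_scale X (a : R) m (f : {ffun X -> R^o}) :
  coefv m (a *: f) = \sum_(b <- msupp a) a@_b *: coefv m (('X_[b] : R) *: f).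
Proof.
rewrite {1}(mpolyE a) scaler_suml raddf_sum; apply: eq_bigr => b _.
apply/ffunP => x; rewrite !ffunE [LHS](_ : _ = (a@_b *: ('X_[b] * (f x : R)))@_m).
  by rewrite mcoeffZ.
by rewrite scalerAl.
Qed.

Lemma sqrel_submod X (N : {set 'I_n} -> {ffun X -> K^o} -> Prop) :
  squarefree N -> submod (sqrel N).
Proof.
case=> sN incN; split=> [m|f g Lf Lg m|a f Lf m].
- by rewrite raddf0; case: (sN (supp m)).
- by rewrite raddfD; case: (sN (supp m)) => _ + _; apply.
rewrite coefv_scale; apply: submod_sum => // b _.
case: (sN (supp m)) => N0 _ NZ; apply: NZ; rewrite coefv_scaleX.
case: ifP => // bm; apply: incN (Lf _); apply: supp_sub_le; exact: lem_subr.
Qed.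

Lemma sqrel_homogm X (N : {set 'I_n} -> {ffun X -> K^o} -> Prop) :
  squarefree N -> homogm (sqrel N).
Proof.
case=> sN _ d f Lf m.
have -> : coefv m (hcv d 0 f) = if (mdeg m + 0 == d)%N then coefv m f else 0.
  by apply/ffunP => x; case: ifP => h; rewrite !ffunE mcoeff_hc h.
by case: ifP => // _; case: (sN (supp m)).
Qed.

Section OneFace.

Variables (X : finType) (P : {ffun X -> K^o} -> Prop).
Hypothesis sP : submod P.

(** The relations of [K[x_G]] tensored with [K^X / P]: in degrees whose support is not inside [G]
    everything is a relation. *)
Definition face G F (u : {ffun X -> K^o}) : Prop := F \subset G -> P u.

Lemma face_squarefree G : squarefree (face G).
Proof.
split=> [F|F F' u FF' h F'G]; last by apply: h; apply: subset_trans F'G.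
case: sP => P0 PD PZ; split=> [_|u v hu hv FG|a v hv FG] //.
  by apply: PD; [apply: hu|apply: hv].
by apply: PZ; apply: hv.
Qed.

Lemma face_zero G S (f : {ffun X -> R^o}) :
  ~~ (S \subset G) -> sqrel (face G) (('X_[mesym1 S] : R) *: f).
Proof.
move=> SG m mG; rewrite coefv_scaleX mesym1_le; case: ifP => [Sm|_]; last by case: sP.
by case/negP: SG; apply: subset_trans mG.
Qed.

Lemma face_nzd G i : i \in G -> nzd (sqrel (face G)) ('X_i : R).
Proof.
move=> iG f h m mG; have := h (m + U_(i))%MM; rewrite coefv_scaleX.
rewrite lem_addl addmK; apply; rewrite suppD subUset mG /=.
apply/subsetP => j; by rewrite inE mnm1E; have [<-|] := eqVneq i j.
Qed.

(** Setting [x_i] to 0 turns [K[x_G]] into the polynomial ring on [G :\ i]; [w] collects the terms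
    of [f] divisible by [x_i]. *)
Lemma face_addm G i (f : {ffun X -> R^o}) : i \in G ->
  addm (sqrel (face G)) ('X_i : R) f <-> sqrel (face (G :\ i)) f.
Proof.
move=> iG; split=> [[w h] m mG|h].
  have [mG' mi] := (subset_trans mG (subD1set G i), subsetP mG i).
  have := h m mG'; rewrite coefvB coefv_scaleX lep1mP.
  case: ifP => [mi0|_]; last by rewrite subr0.
  by have := mi; rewrite !inE mi0 eqxx => /(_ isT).
pose w x : R := \sum_(m <- msupp (f x : R) | m i != 0%N) (f x : R)@_m *: 'X_[m - U_(i)].
have ew x : 'X_i * w x = mpart (fun m => m i != 0%N) (f x : R).
  rewrite mulr_sumr; apply: eq_bigr => m mi.
  by rewrite -scalerAr -mpolyXD addmC submK // lep1mP.
pose W : {ffun X -> R^o} := [ffun x => w x].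
exists W => m mG.
have -> : coefv m (f - ('X_i : R) *: W) =
    if m i != 0%N then 0 else coefv m f.
  apply/ffunP => x; case: ifP => mi; rewrite !ffunE.
    by rewrite [LHS]mcoeffB [X in _ - X@_m]ew mcoeff_mpart mi subrr.
  by rewrite [LHS]mcoeffB [X in _ - X@_m]ew mcoeff_mpart mi subr0.
case: ifP => [_|mi]; first by case: sP.
by apply: h; rewrite subsetD1 mG inE mi.
Qed.

Definition es k : seq R := [seq mesym n K j | j <- iota 1 k].

Lemma esS k : es k.+1 = rcons (es k) (mesym n K k.+1).
Proof. by rewrite /es -[in iota _ _](addn1 k) iotaD map_cat cats1 add1n. Qed.

Lemma mesym_homog k : mono (fun m => mdeg m == k) (mesym n K k).
Proof.
rewrite /mesym; apply: mono_sum => S /eqP cS.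
by rewrite prod_mesym1; apply/monoXm; rewrite mdeg_mesym1 cS.
Qed.

Lemma es_homog k a : a \in es k -> exists j, mono (fun m => mdeg m == j) a.
Proof. by case/mapP => j _ ->; exists j; apply: mesym_homog. Qed.

(* On [k] variables [e_k] is the product of all of them, and each variable is
   a nonzerodivisor modulo [e_1, ..., e_(k-1)], because these stay regular when
   that variable is set to 0. *)
Lemma face_reg G : reg (sqrel (face G)) (es #|G|).
Proof.
have [k] := ubnP #|G|; elim: k G => // k IH G.
have sL := sqrel_submod (face_squarefree G).
have hL := sqrel_homogm (face_squarefree G).
case cG: #|G| => [|c] // ck.
have swap i : i \in G -> reg (sqrel (face G)) (es c) /\
    nzd (foldl (@addm _ _) (sqrel (face G)) (es c)) ('X_i : R).
  move=> iG; apply: reg_swap => //.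
  - by apply/monoXm; rewrite mdeg1.
  - exact: es_homog.
  - exact: face_nzd.
  have := cardsD1 i G; rewrite iG cG add1n => -[cGi].
  have := IH (G :\ i); rewrite -cGi => /(_ ck); apply: eq_reg => v.
  by split=> /face_addm; apply.
rewrite esS; apply/reg_rcons; split.
  have /card_gt0P[i iG] : (0 < #|G|)%N by rewrite cG.
  by have [] := swap i iG.
set L := foldl _ _ _ in swap *.
have sL' : submod L by apply: submod_addms.
move=> v; rewrite /mesym (bigD1 G) /=; last by rewrite cG.
rewrite scalerDl => h.
have : nzd L (\prod_(i in G) ('X_i : R)) by apply: nzd_prod => i /swap[].
apply; have -> : (\prod_(i in G) 'X_i : R) *: v =
  (\prod_(i in G) 'X_i : R) *: v +
  (\sum_(i : {set 'I_n} | (#|i| == c.+1) && (i != G)) \prod_(j in i) 'X_j : R) *: v -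
  (\sum_(i : {set 'I_n} | (#|i| == c.+1) && (i != G)) \prod_(j in i) 'X_j : R) *: v.
  by rewrite addrK.
apply: submodB => //; apply: addms_sub; rewrite scaler_suml.
apply: submod_sum => // S /andP[/eqP cS SG]; rewrite prod_mesym1.
apply: face_zero; apply: contra SG => SG.
by rewrite eqEcard SG cG cS leqnn.
Qed.

End OneFace.

(** The weight removes the terms with [k] in [F], so for [S] containing [F] only faces still
    containing [F] contribute: this is the coboundary of the link of [F]. *)
Definition dF X F (c : {set 'I_n} -> {ffun X -> K^o}) : {set 'I_n} -> {ffun X -> K^o} :=
  cod (fun k => (k \notin F)%:R) c.

Lemma dFB X F (c c' : {set 'I_n} -> {ffun X -> K^o}) S :
  dF F (fun T => c T - c' T) S = dF F c S - dF F c' S.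
Proof. exact: codB. Qed.

Lemma dF_dF X F (c : {set 'I_n} -> {ffun X -> K^o}) S : dF F (dF F c) S = 0.
Proof. exact: cod_cod. Qed.

Lemma dF_mem X (L : {ffun X -> K^o} -> Prop) F (c : {set 'I_n} -> {ffun X -> K^o}) S :
  submod L -> (forall k, k \in S -> k \notin F -> L (c (S :\ k))) -> L (dF F c S).
Proof.
move=> sL h; apply: submod_sum => // k kS; apply: submod_sv => //.
have [kF|kF] := boolP (k \in F); last by case: sL => _ _; apply; apply: h.
by rewrite scale0r; case: sL.
Qed.

(* Vanishing of the cohomology below degree [d] of every link. *)
Definition acyclic X (N : {set 'I_n} -> {ffun X -> K^o} -> Prop) (d : nat) : Prop :=
  forall F q (c : {set 'I_n} -> {ffun X -> K^o}), (q < d)%N ->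
    (forall S, F \subset S -> #|S| = q.+1 -> N S (dF F c S)) ->
  exists b, forall S, F \subset S -> #|S| = q -> N S (c S - dF F b S).

Section Step.

Variables (X : finType) (N : {set 'I_n} -> {ffun X -> K^o} -> Prop) (d : nat).
Hypothesis sN : squarefree N.
Hypothesis dimN : forall F, (d.+1 < #|F|)%N -> forall u, N F u.
Hypothesis acN : acyclic N d.+1.
Local Notation X' := ({set 'I_n} * X)%type.

Definition slice (V : lmodType K) G (g : {ffun X' -> V}) : {ffun X -> V} :=
  [ffun x => g (G, x)].

Fact slice_is_linear (V : lmodType K) G : linear (@slice V G).
Proof. by move=> a f g; apply/ffunP => x; rewrite !ffunE. Qed.
HB.instance Definition _ (V : lmodType K) G :=
  GRing.isLinear.Build K _ _ _ (@slice V G) (slice_is_linear G).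

Definition diag (A : nzRingType) (V : lmodType A) (u : {ffun X -> V}) : {ffun X' -> V} :=
  [ffun p => u p.2].

Fact diag_is_linear (A : nzRingType) (V : lmodType A) : linear (@diag A V).
Proof. by move=> a f g; apply/ffunP => x; rewrite !ffunE. Qed.
HB.instance Definition _ (A : nzRingType) (V : lmodType A) :=
  GRing.isLinear.Build A _ _ _ (@diag A V) (@diag_is_linear A V).

Lemma slice_diag G (u : {ffun X -> K^o}) : slice G (diag u) = u.
Proof. by apply/ffunP => x; rewrite !ffunE. Qed.

Lemma slice_dF G F c S : slice G (dF F c S) = dF F (fun T => slice G (c T)) S.
Proof. exact: cod_linear. Qed.

Lemma diag_dF F c S : diag (dF F c S) = dF F (fun T => diag (c T)) S.
Proof. exact: cod_linear. Qed.

(** Relations of the direct sum of the modules [K[x_G]] tensored with [K^X / N G] over all [G] of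
    size [d.+1]; [cohull] gives those of the cokernel of the diagonal map into it. *)
Definition hull F (g : {ffun X' -> K^o}) : Prop :=
  forall G, (#|G| == d.+1) && (F \subset G) -> N G (slice G g).

Definition cohull F (g : {ffun X' -> K^o}) : Prop :=
  exists u, forall G, (#|G| == d.+1) && (F \subset G) -> N G (slice G g - u).

Lemma hull_squarefree : squarefree hull.
Proof.
case: sN => smN _; split=> [F|F F' g FF' h G /andP[cG F'G]]; last first.
  by apply: h; rewrite cG (subset_trans FF').
split=> [G _|u v hu hv G hG|a v hv G hG]; case: (smN G) => N0 ND NZ.
- by rewrite linear0.
- by rewrite linearD; apply: ND; [apply: hu|apply: hv].
- by rewrite linearZ; apply: NZ; apply: hv.
Qed.

Lemma cohull_squarefree : squarefree cohull.
Proof.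
case: sN => smN _; split=> [F|F F' g FF' [u h]]; last first.
  by exists u => G /andP[cG F'G]; apply: h; rewrite cG (subset_trans FF').
split=> [|g h [u hu] [v hv]|a g [u hu]].
- by exists 0 => G _; rewrite linear0 subr0; case: (smN G).
- exists (u + v) => G hG; case: (smN G) => N0 ND NZ.
  by rewrite linearD opprD addrACA; apply: ND; [apply: hu|apply: hv].
- exists (a *: u) => G hG; case: (smN G) => N0 ND NZ.
  by rewrite linearZ -scalerBr; apply: NZ; apply: hu.
Qed.

(** Injectivity of the diagonal map, by descending induction on [#|F|]. As [u] is zero on all larger
    faces, the constant cochain [u] is a cocycle at the bottom of the link of [F], where every
    coboundary is zero. *)
Lemma hull_inj F u :
  (forall G, (#|G| == d.+1) && (F \subset G) -> N G u) -> N F u.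
Proof.
have [r] := ubnP (d.+2 - #|F|)%N; elim: r F => // r IH F rF h.
have [/dimN//|Fd] := ltnP d.+1 #|F|.
have [cF|cF] := eqVneq #|F| d.+1; first by apply: h; rewrite cF subxx eqxx.
have ltF : (#|F| < d.+1)%N by rewrite ltn_neqAle cF.
have [S FS cS|b hb] := acN (F := F) (c := fun=> u) ltF.
  apply: dF_mem => [|k _ _]; first by case: sN.
  apply: IH => [|G /andP[cG SG]]; last by apply: h; rewrite cG (subset_trans FS).
  by rewrite cS; move: rF ltF; clear; lia.
have := hb F (subxx _) erefl; rewrite [dF F b F]big1 ?subr0 // => k kF.
by rewrite kF scale0r sv0.
Qed.

(** In the summand of [G] the link of [F] is the full simplex on [G :\: F], contracted by any of its
    vertices. If there is none, a set [S] between [F] and [G] would equal [G], which is larger than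
    [q]. *)
Lemma hull_acyclic : acyclic hull d.+1.
Proof.
move=> F q c qd hc.
have /choice_fun[b hb] : forall G, exists b : {set 'I_n} -> {ffun X -> K^o},
    #|G| == d.+1 -> forall S, F \subset S -> S \subset G -> #|S| = q ->
    N G (slice G (c S) - dF F b S).
  move=> G; have [kp|] := set_0Vmem (G :\: F); last first.
    move=> [k]; rewrite inE => /andP[kF kG].
    exists (annih k (fun T => slice G (c T))) => cG S FS SG cS.
    have := cod_annih (fun k => (k \notin F)%:R) k (fun T => slice G (c T)) S.
    rewrite kF scale1r => <-; rewrite -/(dF F (annih k _) S) addrC addKr /annih.
    have smN := sN.1 G; case: ifP => kS; first by case: smN.
    rewrite -/(dF F _ (k |: S)) -slice_dF.
    apply: submod_sv => //; apply: hc.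
    - by apply: subset_trans FS _; apply: subsetUr.
    - by rewrite cardsU1 kS cS.
    - by rewrite cG subUset sub1set kG.
  exists (fun=> 0) => /eqP cG S FS SG cS.
  have GF : G \subset F by rewrite -setD_eq0 kp.
  have := subset_leq_card (subset_trans GF FS).
  by rewrite cG cS leqNgt qd.
exists (fun T => [ffun p => b p.1 T p.2]) => S FS cS G /andP[cG SG].
rewrite linearB /= slice_dF.
have -> : dF F (fun T => slice G [ffun p => b p.1 T p.2]) S = dF F (b G) S.
  by apply: eq_cod => k _; apply/ffunP => x; rewrite !ffunE.
exact: hb.
Qed.

(** The long exact sequence by hand: the coboundary of [c] lifts to [u], a cocycle by injectivity,
    hence the coboundary of some [b] by [acN] one size higher. Then [c] minus the diagonal of [b] is
    a cocycle of [hull]. *)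
Lemma cohull_acyclic : acyclic cohull d.
Proof.
move=> F q c qd hc.
have /choice_fun[u hu] : forall S, exists u, F \subset S -> #|S| = q.+1 ->
    forall G, (#|G| == d.+1) && (S \subset G) -> N G (slice G (dF F c S) - u).
  move=> S; have [[FS cS]|nS] := excluded_middle_informative (F \subset S /\ #|S| = q.+1).
    by have [u hu] := hc S FS cS; exists u.
  by exists 0 => FS cS; case: nS.
have [S FS cS|b hb] := @acN F q.+1 u qd.
  apply: hull_inj => G /andP[cG SG]; have smN := sN.1 G.
  rewrite -[dF F u S]opprK; apply: submodN => //.
  have -> : - dF F u S = dF F (fun T => slice G (dF F c T) - u T) S.
    by rewrite dFB -slice_dF dF_dF linear0 sub0r.
  apply: dF_mem => // k kS kF; apply: hu.
  - by rewrite subsetD1 FS.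
  - by have := cardsD1 k S; rewrite kS cS add1n => -[].
  - by rewrite cG (subset_trans (subD1set _ _)).
have [S FS cS|b' hb'] := @hull_acyclic F q (fun S => c S - diag (b S)) (ltnW qd).
  move=> G /andP[cG SG]; have smN := sN.1 G.
  rewrite dFB linearB /= -diag_dF slice_diag.
  rewrite -(subrK (u S) (slice G _)) -addrA; case: (smN) => _ ND _; apply: ND.
    by apply: hu => //; rewrite cG.
  by apply: sN.2 (hb S FS cS).
exists b' => S FS cS; exists (b S) => G hG.
have := hb' S FS cS G hG.
by rewrite addrAC linearB /= slice_diag.
Qed.

Lemma hull_diag F u : hull F (diag u) <-> N F u.
Proof.
split=> h; first by apply: hull_inj => G /h; rewrite slice_diag.
by move=> G /andP[_ FG]; rewrite slice_diag; apply: sN.2 h.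
Qed.

Lemma coefv_diag m (f : {ffun X -> R^o}) : coefv m (diag f) = diag (coefv m f).
Proof. by apply/ffunP => p; rewrite !ffunE. Qed.

(** A preimage is chosen in each degree separately; cutting off where [g] has no more terms makes
    the choices a polynomial. *)
Lemma sqrel_cohull (g : {ffun X' -> R^o}) :
  sqrel cohull g <-> exists f, sqrel hull (g - diag f).
Proof.
split=> [h|[f h] m]; last first.
  exists (coefv m f) => G /h; rewrite coefvB coefv_diag linearB /=.
  by rewrite slice_diag.
have /choice_fun[u hu] := h.
pose M := (\max_p msize (g p : R))%N.
pose f : {ffun X -> R^o} := [ffun x => mtrunc M (fun m => u m x)].
exists f => m G hG; rewrite coefvB coefv_diag linearB /= slice_diag.
have ef : coefv m f = if (mdeg m < M)%N then u m else 0.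
  apply/ffunP => x; rewrite [LHS]ffunE [f x]ffunE mcoeff_mtrunc.
  by case: ifP => // _; rewrite ffunE.
rewrite ef; case: ltnP => Mm; first exact: hu.
have -> : coefv m g = 0; last by rewrite linear0 subrr; case: (sN.1 G).
apply/ffunP => p; rewrite !ffunE; apply: memN_msupp_eq0; apply: msize_mdeg_ge.
by apply: leq_trans Mm; apply: (leq_bigmax (F := fun p => msize (g p : R))).
Qed.

Lemma hull_reg : reg (sqrel hull) (es d.+1).
Proof.
have := @reg_family _ X {set 'I_n} _ (fun G => #|G| == d.+1)
  (fun G => sqrel (face (N G) G)) (es d.+1).
move=> h; apply: eq_reg (h _) => [g|G /eqP <-]; last by apply: face_reg; case: sN.
split=> hg.
  move=> m G /andP[cG mG]; have := hg G cG m mG; congr (N G _).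
  by apply/ffunP => x; rewrite !ffunE.
move=> G cG m mG; have := hg m G; rewrite cG mG => /(_ isT); congr (N G _).
by apply/ffunP => x; rewrite !ffunE.
Qed.

End Step.

Theorem acyclic_reg d X (N : {set 'I_n} -> {ffun X -> K^o} -> Prop) :
    squarefree N -> (forall F, (d < #|F|)%N -> forall u, N F u) -> acyclic N d ->
  reg (sqrel N) (es d).
Proof.
elim: d X N => // d IH X N sN dimN acN.
apply: (reg_depth (phi := @diag X R R^o) (L' := sqrel (hull N d))
          (L'' := sqrel (cohull N d))).
- exact/sqrel_submod/hull_squarefree.
- by move=> f; split=> h m; have := h m; rewrite coefv_diag hull_diag.
- exact: sqrel_cohull.
- exact: hull_reg.
rewrite size_map size_iota esS -cats1 take_size_cat ?size_map ?size_iota //.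
apply: IH.
- exact: cohull_squarefree.
(* A set [G] of size [d.+1] containing [F] can only be [F] itself, so one component to be lifted
   remains. *)
- move=> F dF u; exists (slice F u) => G /andP[/eqP cG FG].
  have -> : G = F by apply/esym/eqP; rewrite eqEcard FG cG.
  by rewrite subrr; case: (sN.1 F).
- exact: cohull_acyclic.
Qed.

End SquarefreeModules.

(** * Duality for links *)

Section Duality.

Variable K : fieldType.

(** The columns of [B] span the annihilator of its left kernel: one inclusion is clear and the ranks
    agree. *)
Lemma kermx_mul_eq0 (p q r : nat) (B : 'M[K]_(p, q)) (u : 'M[K]_(p, r)) :
  kermx B *m u = 0 -> exists w, u = B *m w.
Proof.
move=> ku; suff /submxP[w hw] : (u^T <= B^T)%MS.
  by exists w^T; apply: trmx_inj; rewrite hw trmx_mul trmxK.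
have eB : (B^T == kermx (kermx B)^T)%MS.
  rewrite -(geq_leqif (mxrank_leqif_eq _)).
    by rewrite mxrank_ker !mxrank_tr mxrank_ker subKn ?rank_leq_row.
  by apply/sub_kermxP; rewrite -trmx_mul mulmx_ker trmx0.
by rewrite (eqmxP eB); apply/sub_kermxP; rewrite -trmx_mul ku trmx0.
Qed.

(** Exactness passes to the transposed maps: the left kernel of [b] is contained in the image of
    [a], so [v] is orthogonal to it and [kermx_mul_eq0] applies. *)
Lemma dual_exact (X Y Z : finType) (P : pred Y) (a : X -> Y -> K) (b : Y -> Z -> K) :
    (forall v : Y -> K, (forall z, \sum_(y | P y) v y * b y z = 0) ->
      exists w : X -> K, forall y, P y -> v y = \sum_x w x * a x y) ->
  forall v : Y -> K, (forall x, \sum_(y | P y) a x y * v y = 0) ->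
    exists w : Z -> K, forall y, P y -> v y = \sum_z b y z * w z.
Proof.
move=> ex v av.
pose B := \matrix_(y < #|Y|, z < #|Z|)
  if P (enum_val y) then b (enum_val y) (enum_val z) else 0.
pose u := \col_(y < #|Y|) if P (enum_val y) then v (enum_val y) else 0.
have sumE (T : finType) (f : T -> K) : \sum_(i < #|T|) f (enum_val i) = \sum_t f t.
  rewrite [RHS](reindex (@enum_val T predT)) //=.
  by apply: onW_bij; exists enum_rank; [exact: enum_valK|exact: enum_rankK].
have [|w hw] := @kermx_mul_eq0 _ _ _ B u.
  apply/row_matrixP => i; rewrite row0 row_mul; set k := row i _.
  have kB : k *m B = 0 by apply/sub_kermxP; apply: row_sub.
  have [z|w hw] := ex (fun y => k 0 (enum_rank y)).
    have /rowP/(_ (enum_rank z)) := kB; rewrite !mxE => kBz.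
    rewrite -[RHS]kBz big_mkcond -[LHS]sumE; apply: eq_bigr => y _.
    by rewrite [B _ _]mxE enum_valK enum_rankK; case: ifP; rewrite ?mulr0.
  apply/rowP => j; rewrite !mxE.
  transitivity (\sum_x w x * \sum_(y | P y) a x y * v y); last first.
    by rewrite big1 // => x _; rewrite av mulr0.
  transitivity (\sum_(y | P y) (\sum_x w x * a x y) * v y).
    rewrite [RHS]big_mkcond -[RHS]sumE; apply: eq_bigr => y _.
    by rewrite [u _ _]mxE; case: ifP => [/hw <-|]; rewrite ?enum_valK ?mulr0.
  under eq_bigr => y _ do rewrite mulr_suml.
  rewrite exchange_big; apply: eq_bigr => x _; rewrite mulr_sumr.
  by apply: eq_bigr => y _; rewrite mulrA.
exists (fun z => w (enum_rank z) 0) => y Py.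
have /matrixP/(_ (enum_rank y) 0) := hw; rewrite !mxE enum_rankK Py => ->.
rewrite -[RHS]sumE; apply: eq_bigr => z _.
by rewrite [B _ _]mxE enum_rankK Py enum_valK.
Qed.

Variables (n : nat) (D : pred {set 'I_n}).
Hypothesis subD : forall S T : {set 'I_n}, S \subset T -> D T -> D S.
Implicit Types (F S T x y z : {set 'I_n}) (c b : {set 'I_n} -> K^o) (k : 'I_n).

Definition off F (k : 'I_n) : K := (k \notin F)%:R.

(* For every [F], acyclicity of the cochain (resp. chain) complex of the link
   of [F] in the simplicial complex [D], in sizes below [d]; a face of the link
   is represented by its union with [F]. *)
Definition coexact (d : nat) : Prop := forall F q c, (q < d)%N ->
    (forall S, F \subset S -> #|S| = q.+1 -> D S -> cod (off F) c S = 0) ->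
  exists b, forall S, F \subset S -> #|S| = q -> D S -> c S = cod (off F) b S.

Definition chexact (d : nat) : Prop := forall F q c, (q < d)%N ->
    (forall S, ~~ D S -> c S = 0) ->
    (forall S, F \subset S -> #|S|.+1 = q -> dl (fun=> 1) c S = 0) ->
  exists b, (forall S, ~~ D S -> b S = 0) /\
    forall S, F \subset S -> #|S| = q -> c S = dl (fun=> 1) b S.

Section Incidence.

Variable F : {set 'I_n}.

(** The incidence matrix of the link; at most one [k] contributes to the sum. *)
Definition inc x y : K := \sum_(k in y | y :\ k == x) sv (sb k x) (off F k).

Definition good (q : nat) S := [&& F \subset S, #|S| == q & D S].

Lemma mulrsv (b : bool) (u v : K) : u * sv b v = sv b (u * v).
Proof. by case: b; rewrite //= mulrN. Qed.

Lemma cod_inc c y : cod (off F) c y = \sum_x c x * inc x y.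
Proof.
under [RHS]eq_bigr => x _ do rewrite mulr_sumr.
rewrite (exchange_big_dep (fun k => k \in y)) /=; last by move=> x k _ /andP[].
apply: eq_bigr => k ky; rewrite (big_pred1 (y :\ k)) => [|x].
  by rewrite mulrsv mulrC.
by rewrite /= ky eq_sym.
Qed.

Lemma inc_neq0 q x y : good q y -> inc x y != 0 -> F \subset x /\ #|x|.+1 = q.
Proof.
case/and3P=> Fy /eqP cy _ /eqP xy.
case: (pickP (fun k => [&& k \in y, y :\ k == x & k \notin F])) => [k|h].
  case/and3P=> ky /eqP <- kF; rewrite subsetD1 Fy kF.
  by have := cardsD1 k y; rewrite ky cy add1n => <-.
case: xy; apply: big1 => k /andP[ky kx].
by have := h k; rewrite ky kx /off => /= ->; rewrite sv0.
Qed.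

Lemma cod_good q c z : good q.+1 z ->
  cod (off F) c z = \sum_(y | good q y) c y * inc y z.
Proof.
move=> gz; rewrite cod_inc [LHS](bigID (good q)) /= [X in _ + X]big1 ?addr0 // => y.
move=> ngy; have [->|h] := eqVneq (inc y z) 0; first by rewrite mulr0.
have [Fy [cy]] := inc_neq0 gz h; case/negP: ngy; rewrite /good Fy cy eqxx /=.
case: (pickP (fun k => (k \in z) && (z :\ k == y))) => [k /andP[kz /eqP <-]|hk].
  by case/and3P: gz => _ _; apply: subD; apply: subD1set.
by case/eqP: h; apply: big_pred0.
Qed.

Lemma dl_good q c x : (forall S, ~~ D S -> c S = 0) -> F \subset x -> #|x|.+1 = q ->
  dl (fun=> 1) c x = \sum_(y | good q y) inc x y * c y.
Proof.
move=> c0 Fx cx.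
transitivity (\sum_y inc x y * c y); last first.
  rewrite (bigID (good q)) /= [X in _ + X]big1 ?addr0 // => y ngy.
  have [Dy|nDy] := boolP (D y); last by rewrite c0 ?mulr0.
  rewrite [inc x y]big1 ?mul0r // => k /andP[ky /eqP ex].
  case/negP: ngy; rewrite /good Dy andbT -cx -ex.
  by rewrite (cardsD1 k y) ky eqxx andbT (subset_trans Fx) // -ex subD1set.
under [RHS]eq_bigr => y _ do rewrite mulr_suml.
rewrite (exchange_big_dep predT) //= [LHS]big_mkcond /=; apply: eq_bigr => k _.
case: ifP => kx.
  rewrite (big_pred1 (k |: x)) => [|y].
    rewrite scale1r /off (contra (subsetP Fx k)) ?kx //.
    by case: sb; rewrite /= ?mulN1r ?mul1r.
  apply/andP/eqP => [[ky /eqP <-]|->]; first by rewrite setD1K.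
  by rewrite setU11 setU1K.
rewrite big_pred0 // => y; apply/negP => /andP[ky /eqP ex].
by rewrite -ex setD11 in kx.
Qed.

End Incidence.

Lemma coexact_chexact d : coexact d -> chexact d.
Proof.
move=> ex F q c qd c0 hc.
(* [dual_exact] restricts only the middle index, so the columns of non-faces are set to zero. *)
have [v|x|w hw] := @dual_exact _ _ _ (good F q) (inc F)
    (fun y z => if good F q.+1 z then inc F y z else 0) _ c.
- move=> hv; have [S FS cS DS|b hb] := ex F q v qd.
    have gS : good F q.+1 S by rewrite /good FS cS eqxx.
    have := hv S; rewrite gS => h; by rewrite (cod_good _ gS).
  exists b => y /and3P[Fy /eqP cy Dy]; by rewrite hb // cod_inc.
- have [/andP[Fx /eqP cx]|nx] := boolP ((F \subset x) && (#|x|.+1 == q)).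
    by rewrite -dl_good // hc.
  apply: big1 => y gy; have [->|h] := eqVneq (inc F x y) 0; first by rewrite mul0r.
  by have [Fx cx] := inc_neq0 gy h; rewrite Fx cx eqxx in nx.
pose b S := if good F q.+1 S then w S else 0.
have b0 S : ~~ D S -> b S = 0 by rewrite /b /good => /negPf ->; rewrite !andbF.
exists b; split=> // S FS cS.
rewrite (dl_good b0 FS (q := q.+1)) ?cS //.
have [DS|nDS] := boolP (D S).
  rewrite hw; last by rewrite /good FS cS eqxx.
  rewrite [RHS]big_mkcond; apply: eq_bigr => z _; rewrite /b.
  by case: ifP; rewrite ?mul0r.
rewrite c0 // big1 // => z /and3P[_ _ Dz].
rewrite [inc F S z]big1 ?mul0r // => k /andP[kz /eqP ez].
by case/negP: nDS; rewrite -ez; apply: subD Dz; apply: subD1set.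
Qed.

Lemma chexact_coexact d : chexact d -> coexact d.
Proof.
move=> ex F q c qd hc.
have [v|z|w hw] := @dual_exact _ _ _ (good F q)
    (fun z y => if good F q.+1 z then inc F y z else 0) (fun y x => inc F x y) _ c.
- move=> hv; pose v' S := if good F q S then v S else 0.
  have v0 S : ~~ D S -> v' S = 0 by rewrite /v' /good => /negPf ->; rewrite !andbF.
  have [S FS cS|b [b0 hb]] := ex F q v' qd v0.
    rewrite (dl_good v0 FS cS) -[RHS](hv S); apply: eq_bigr => y gy.
    by rewrite /v' gy mulrC.
  exists b => y gy; have /and3P[Fy /eqP cy _] := gy.
  have := hb y Fy cy; rewrite {1}/v' gy => ->.
  rewrite (dl_good b0 Fy (q := q.+1)) ?cy // big_mkcond; apply: eq_bigr => z _.
  by case: ifP; rewrite ?mulr0 // mulrC.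
- case gz: (good F q.+1 z); last by rewrite big1 // => y _; rewrite mul0r.
  have /and3P[Fz /eqP cz Dz] := gz; rewrite -[RHS](hc z Fz cz Dz) (cod_good _ gz).
  by apply: eq_bigr => y _; rewrite mulrC.
exists w => S FS cS DS; rewrite hw ?cod_inc; last by rewrite /good FS cS eqxx.
by apply: eq_bigr => x _; rewrite mulrC.
Qed.

End Duality.

(** * Koszul cohomology and regular sequences *)

Section RegularIdeals.

Variable A : comNzRingType.
Implicit Types (I : A^o -> Prop) (s : seq A) (f g : A^o).

Lemma reg_nth (V : lmodType A) (L : V -> Prop) s :
  reg L s <-> forall k, (k < size s)%N -> nzd (foldl (@addm A V) L (take k s)) s`_k.
Proof.
elim: s L => [|a s IH] L; first by split.
split=> [[za /IH h] [|k] ks|h]; [exact: za|exact: h|].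
by split; [exact: (h 0%N)|apply/IH => k; exact: (h k.+1)].
Qed.

Lemma ideal_submod I : is_ideal (I : A -> Prop) -> submod I.
Proof. by case=> I0 ID IM; split. Qed.

Lemma submod_ideal I : submod I -> is_ideal (I : A -> Prop).
Proof. by case=> I0 ID IM; split. Qed.

Lemma ideal_plusE I s f : is_ideal (I : A -> Prop) ->
  ideal_plus I s f <-> foldl (@addm A A^o) I s f.
Proof.
elim: s I => [|a s IH] I idI.
  split=> [|If]; first by apply: ideal_gen_min => // g [|].
  by apply: ideal_gen_sub; left.
have idIa : is_ideal (addm I a : A -> Prop).
  by apply/submod_ideal/submod_addm/ideal_submod.
apply: iff_trans (IH _ idIa); split.
  apply: ideal_gen_min => [|g]; first exact: ideal_gen_is_ideal.
  rewrite inE => -[Ig|/orP[/eqP->|gs]]; apply: ideal_gen_sub; last by right.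
    by left; apply: addm_sub.
  left; exists 1; rewrite /GRing.scale /= mulr1 subrr; by case: idI.
apply: ideal_gen_min => [|g [[w Iw]|gs]]; first exact: ideal_gen_is_ideal.
  have [_ JD JM] := ideal_gen_is_ideal (fun g => I g \/ g \in a :: s).
  rewrite -[g](subrK (a *: w)); apply: JD; first by apply: ideal_gen_sub; left.
  rewrite /GRing.scale /= mulrC; apply: JM; apply: ideal_gen_sub; right.
  exact: mem_head.
by apply: ideal_gen_sub; right; rewrite inE gs orbT.
Qed.

Lemma regular_seqE I s : is_ideal (I : A -> Prop) ->
  regular_seq I s <-> ~ ideal_plus I s 1 /\ reg I s.
Proof.
move=> idI; split=> -[pI h]; split=> //.
  by apply/reg_nth => k ks v /ideal_plusE-/(_ idI)/(h k ks)/ideal_plusE; apply.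
move/reg_nth: h => h k ks g /ideal_plusE-/(_ idI) hg.
by apply/ideal_plusE => //; apply: h.
Qed.

End RegularIdeals.

Section KoszulVanishing.

Variables (A : comNzRingType) (V : lmodType A) (n : nat) (y : 'I_n -> A).
Implicit Types (L : V -> Prop) (z w c : {set 'I_n} -> V) (S T : {set 'I_n}).

Lemma cod_mem L z S :
  submod L -> (forall k, k \in S -> L (z (S :\ k))) -> L (cod y z S).
Proof.
move=> sL h; apply: submod_sum => // k kS; apply: submod_sv => //.
by case: sL => _ _; apply; apply: h.
Qed.

Lemma cod_annih_sum (r : 'I_n -> A) z S :
  cod y (fun T => \sum_j r j *: annih j z T) S +
    \sum_j r j *: annih j (cod y z) S = (\sum_j r j * y j) *: z S.
Proof.
have -> : cod y (fun T => \sum_j r j *: annih j z T) S =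
    \sum_j r j *: cod y (annih j z) S.
  rewrite /cod; under [RHS]eq_bigr => j _ do rewrite scaler_sumr.
  rewrite exchange_big; apply: eq_bigr => k _; rewrite scaler_sumr sv_sum.
  by apply: eq_bigr => j _; rewrite -svZ !scalerA mulrC.
rewrite -big_split scaler_suml; apply: eq_bigr => j _.
by rewrite /= -scalerDr cod_annih scalerA.
Qed.

(* Some power of an element of [s] acts as zero on cohomology, while the
   induction hypothesis for the quotient makes the element act injectively. *)
Lemma koszul_vanishing L (s : seq A) i z :
    submod L -> reg L s ->
    (forall a, a \in s -> exists N r, a ^+ N = \sum_k r k * y k) ->
    (i < size s)%N -> (forall S, #|S| = i.+1 -> L (cod y z S)) ->
  exists w, forall S, #|S| = i -> L (z S - cod y w S).
Proof.
elim: s L i z => // a s IH L i z sL [za rs] hs ilt hz.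
have [N [r hN]] := hs a (mem_head _ _).
have : exists w, forall S, #|S| = i -> L (a ^+ N *: z S - cod y w S).
  exists (fun T => \sum_j r j *: annih j z T) => S cS.
  rewrite hN -cod_annih_sum addrC addKr; apply: submod_sum => // j _.
  case: (sL) => L0 _ LZ; apply: LZ; rewrite /annih; case: ifPn => // jS.
  by apply: submod_sv => //; apply: hz; rewrite cardsU1 jS cS.
(* Lowering the exponent: if [a ^+ N.+1] times [z] is the coboundary of [w], then [w] is a cocycle
   modulo [a], so [w] is a coboundary plus [a] times some [w'], and cancelling [a] leaves [a ^+ N]
   times [z] as the coboundary of [w']. *)
elim: N {hN} => [[w hw]|N IHN [w hw]]; first by exists w => S /hw; rewrite scale1r.
apply: IHN; case: i ilt hz hw => [|i] ilt hz hw.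
  exists (fun=> 0) => S cS; apply: za.
  have := hw S cS; have -> : S = set0 by apply/eqP; rewrite -cards_eq0 cS.
  by rewrite /cod !big_set0 !subr0 scalerA -exprS.
have sLa := submod_addm a sL.
have [b bs||S cS|v hv] := IH (addm L a) i w sLa rs.
- by apply: hs; rewrite inE bs orbT.
- exact: ilt.
- exists (a ^+ N *: z S); rewrite scalerA -exprS -opprB; apply: submodN => //.
  exact: hw.
have /choice_fun[w' hw'] : forall S, exists x : V, #|S| = i -> L (w S - cod y v S - a *: x).
  move=> S; have [/hv[w' hw']|] := eqVneq #|S| i; first by exists w'.
  by move=> /eqP cS; exists 0.
exists w' => S cS; apply: za; rewrite scalerBr scalerA -exprS.
have e : cod y w S - a *: cod y w' S = cod y (fun T => w T - cod y v T - a *: w' T) S.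
  by rewrite codB codZ codB cod_cod subr0.
rewrite -[_ *: z S](subrK (cod y w S)) -addrA e.
case: (sL) => _ LD _; apply: LD; first exact: hw.
apply: cod_mem => // k kS; apply: hw'.
by have := cardsD1 k S; rewrite kS cS add1n => -[].
Qed.

End KoszulVanishing.

(** * Cohen-Macaulayness in terms of links *)

Section Reisner.

Variables (K : fieldType) (n : nat) (e : rel 'I_n).
Hypothesis e_irr : irreflexive e.
Local Notation R := {mpoly K[n]}.
Local Notation I := (edge_ideal K e).
Local Notation d := (n - alpha0 e)%N.
Implicit Types (F S T : {set 'I_n}) (m : 'X_{1..n}) (f g : R).

Lemma edge_ideal_is_ideal : is_ideal I.
Proof. exact: ideal_gen_is_ideal. Qed.

Definition mu F S : 'X_{1..n} := [multinom if i \in F then 1 else (i \in S).*2 | i < n]%N.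

Lemma muD1 F S k : k \in S -> k \notin F -> mu F S = (mu F (S :\ k) + U_(k) *+ 2)%MM.
Proof.
move=> kS kF; apply/mnmP => i; rewrite mnmDE mulmnE mnm1E !mnmE !inE [i == k]eq_sym.
by case: eqP => [<-|_]; rewrite ?(negPf kF) ?kS //= addn0.
Qed.

Lemma supp_mu F S : F \subset S -> supp (mu F S) = S.
Proof.
move=> FS; apply/setP => i; rewrite inE mnmE.
by case: ifP => [/(subsetP FS) ->//|_]; case: (i \in S).
Qed.

(* The cochain complex of the link of [F] is the strand of the Koszul complex
   on the squares of the variables in which the exponent is 1 on [F] and even
   elsewhere. *)
Lemma reg_coexact (s : seq R) :
    reg (V := R^o) I s -> (forall f, f \in s -> irrelevant f) ->
  coexact K (indep e) (size s).
Proof.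
move=> rs irr F q c qs hc.
have sI : submod (I : R^o -> Prop) by apply/ideal_submod/edge_ideal_is_ideal.
pose y (k : 'I_n) : R := 'X_k ^+ 2.
(* The power [n.+1] suffices: a monomial of degree above [n] in [n] variables is divisible by a
   square of a variable. *)
have hN f : f \in s -> exists N r, f ^+ N = \sum_k r k * y k.
  move=> /irr/irrelevantP hf; exists n.+1; apply: (@mono_powers K n 2).
  have : mono (fun m => n.+1 <= mdeg m)%N (f ^+ n.+1).
    elim: n.+1 => [|N IHN]; first exact: mono1.
    rewrite exprS; apply: (mono2M _ hf IHN) => a b a0 Nb.
    by rewrite mdegD -add1n leq_add // lt0n mdeg_eq0.
  apply: sub_mono => m; apply: contraTT; rewrite negb_exists -ltnNge ltnS.
  move/forallP => h; rewrite mdegE -[X in (_ <= X)%N]card_ord -sum1_card.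
  by apply: leq_sum => i _; have := h i; rewrite -ltnNge ltnS.
pose z S : R^o := if F \subset S then c S *: 'X_[mu F S] else 0.
have ez S k : F \subset S -> k \in S ->
    y k *: z (S :\ k) = (off K F k * c (S :\ k)) *: 'X_[mu F S].
  move=> FS kS; rewrite /z subsetD1 FS /off.
  case: (boolP (k \in F)) => kF; first by rewrite mul0r scale0r scaler0.
  rewrite mul1r (muD1 kS kF) mpolyXD -mpolyXn.
  by rewrite /GRing.scale /= -scalerAr mulrC.
have [S cS|w hw] := koszul_vanishing (z := z) sI rs hN qs.
  have [FS|nFS] := boolP (F \subset S); last first.
    rewrite [cod y z S]big1 => [|k kS]; first by case: edge_ideal_is_ideal.
    rewrite /z ifN ?scaler0 ?sv0 //; apply: contra nFS => /subset_trans; apply.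
    exact: subD1set.
  have -> : cod y z S = cod (off K F) c S *: 'X_[mu F S].
    rewrite /cod scaler_suml; apply: eq_bigr => k kS; rewrite ez //.
    by case: sb; rewrite /= ?scaleNr.
  have [iS|niS] := boolP (indep e S).
    by rewrite hc // scale0r; case: edge_ideal_is_ideal.
  by apply/edge_idealE => //; apply: monoZ; apply/monoXm; rewrite supp_mu.
exists (fun T => (w T : R)@_(mu F T)) => S FS cS iS.
have /edge_idealE-/(_ e_irr) h := hw S cS.
have : (z S - cod y w S : R)@_(mu F S) = 0.
  by apply/eqP; apply: contraTT iS => /h; rewrite supp_mu.
rewrite mcoeffB /z FS mcoeffZ mcoeffX eqxx mulr1 => /eqP; rewrite subr_eq0 => /eqP ->.
rewrite /cod raddf_sum; apply: eq_bigr => k kS.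
have E : (y k *: w (S :\ k) : R)@_(mu F S) =
    off K F k *: ((w (S :\ k) : R)@_(mu F (S :\ k)) : K^o).
  rewrite [LHS](_ : _ = ('X_[U_(k) *+ 2] * (w (S :\ k) : R))@_(mu F S)); last first.
    by rewrite -mpolyXn.
  rewrite /off; case: (boolP (k \in F)) => kF.
    rewrite scale0r mcoeffXM ifN //; apply/negP => /mnm_lepP/(_ k).
    by rewrite mulmnE mnm1E eqxx mnmE kF.
  by rewrite (muD1 kS kF) mcoeffXM lem_addl addmK scale1r.
by rewrite -E; case: sb; rewrite //= raddfN.
Qed.

Lemma coexact_acyclic : coexact K (indep e) d ->
  acyclic (fun F (u : {ffun unit -> K^o}) => indep e F -> u = 0) d.
Proof.
move=> ex F q c qd hc.
have evF (b : {set 'I_n} -> {ffun unit -> K^o}) S :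
    dF F b S tt = cod (off K F) (fun T => b T tt) S.
  rewrite /dF /cod sum_ffunE; apply: eq_bigr => k _.
  by case: sb; rewrite /= !ffunE.
have [S FS cS iS|b hb] := ex F q (fun T => c T tt) qd.
  by rewrite -evF (hc S FS cS iS) ffunE.
exists (fun T => [ffun=> b T]) => S FS cS iS; apply/ffunP => -[].
rewrite !ffunE evF (hb S FS cS iS).
have -> : cod (off K F) (fun T => [ffun=> b T] tt) S = cod (off K F) b S.
  by apply: eq_cod => k _; rewrite ffunE.
exact: subrr.
Qed.

Lemma coexact_regular : coexact K (indep e) d ->
  exists s : seq R,
    [/\ size s = d, forall f, f \in s -> irrelevant f & regular_seq I s].
Proof.
move=> /coexact_acyclic ac; exists (es K n d).
have irr f : f \in es K n d -> irrelevant f.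
  case/mapP => j; rewrite mem_iota => /andP[j0 _] ->; apply/irrelevantP.
  apply: sub_mono (@mesym_homog K n j) => m /eqP mj.
  by rewrite -mdeg_eq0 mj -lt0n.
have e0 : indep e set0 by apply/indepP => i j; rewrite inE.
split=> //; first by rewrite size_map size_iota.
apply/regular_seqE; [exact: edge_ideal_is_ideal|split].
  have id0 : is_ideal (mono (K := K) (fun m : 'X_{1..n} => m != 0%MM)).
    by apply: mono_ideal => a b; apply: contraNN; rewrite mnmD_eq0 => /andP[].
  move/(ideal_gen_min id0) => h.
  have /h : forall g : R, I g \/ g \in es K n d -> mono (fun m => m != 0%MM) g.
    move=> g [/edge_idealE-/(_ e_irr)|/irr/irrelevantP//].
    apply: sub_mono => m; apply: contraNneq => ->.
    rewrite (_ : supp _ = set0) //; apply/setP => i.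
    by rewrite !inE mnm0E.
  by rewrite -mpolyX0 => /monoXm; rewrite eqxx.
pose N := fun F (u : {ffun unit -> K^o}) => indep e F -> u = 0.
have sN : squarefree N.
  split=> [F|F G u FG h iG]; last by apply/h/indepS/iG.
  split=> [//|u v hu hv iF|a v hv iF]; first by rewrite hu // hv // addr0.
  by rewrite hv // scaler0.
have dimN F : (d < #|F|)%N -> forall u, N F u.
  by move=> dF u /indep_card; rewrite leqNgt dF.
have := acyclic_reg sN dimN ac.
pose phi (f : R^o) : {ffun unit -> R^o} := [ffun=> f].
have lin_phi : linear phi by move=> a f g; apply/ffunP => x; rewrite !ffunE.
pose phiL : {linear R^o -> {ffun unit -> R^o}} :=
  HB.pack phi (GRing.isLinear.Build _ _ _ _ phi lin_phi).
have regT (s : seq R) : reg (fun _ : {ffun unit -> R^o} => True) s.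
  elim: s => // a s IH; split=> //; apply: eq_reg IH => v.
  by split=> // _; exists 0.
(* [phiL] is an isomorphism, so regularity is transported by the depth lemma with zero cokernel. *)
move=> h; apply: (reg_depth (phi := phiL) (L' := sqrel N) (L'' := fun=> True) _ _ _ h).
- exact: sqrel_submod.
- move=> f; apply: (iff_trans (edge_idealE _ e_irr)); split=> hf m.
    move=> im; apply/ffunP => x; rewrite !ffunE; apply/eqP.
    by apply: contraTT im => /hf.
  apply: contraNN => im; have /ffunP/(_ tt) := hf m im; rewrite !ffunE => ->.
  exact: eqxx.
- move=> g; split=> // _; exists (g tt : R) => m _.
  by apply/ffunP => -[]; rewrite !ffunE subrr mcoeff0.
- exact: regT.
Qed.

Lemma cohen_macaulay_coexact :
  cohen_macaulay I <-> coexact K (indep e) d.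
Proof.
apply: (iff_trans (cohen_macaulay_edgeP _ e_irr)); split.
  case=> s [<- irr /regular_seqE-/(_ edge_ideal_is_ideal)[_ rs]].
  exact: reg_coexact.
exact: coexact_regular.
Qed.

End Reisner.

(** * Multigraded strands *)

Section Strands.

Variables (K : fieldType) (n : nat).
Local Notation R := {mpoly K[n]}.
Implicit Types (S T F : {set 'I_n}) (a m : 'X_{1..n}) (k : 'I_n) (P Q : pred 'X_{1..n}).
Implicit Types (z w : {set 'I_n} -> R^o) (c b : {set 'I_n} -> K^o).

Definition xs (k : 'I_n) : R := 'X_k.

(** The component of multidegree [a] of the Koszul chain [z], the basis vector of [S] having
    multidegree [mesym1 S]. *)
Definition strand a z S : K^o :=
  if (mesym1 S <= a)%MM then (z S : R)@_(a - mesym1 S) else 0.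

Lemma mesym1U1 S k : k \notin S -> mesym1 (k |: S) = (mesym1 S + U_(k))%MM.
Proof.
move=> kS; apply/mnmP => i; rewrite mnmDE mnm1E !mnmE !inE eq_sym.
by case: eqP => [<-|_]; rewrite /= ?(negPf kS) ?addn0.
Qed.

Lemma mesym1D1 S k : k \in S -> mesym1 S = (mesym1 (S :\ k) + U_(k))%MM.
Proof. by move=> kS; rewrite -mesym1U1 ?setD11 // setD1K. Qed.

Lemma strand_dl a z S : (mesym1 S <= a)%MM ->
  (dl xs z S : R)@_(a - mesym1 S) = dl (fun=> 1) (strand a z) S.
Proof.
move=> Sa; rewrite /dl raddf_sum; apply: eq_bigr => k kS.
have E : (xs k *: z (k |: S) : R)@_(a - mesym1 S) = 1 *: strand a z (k |: S).
  rewrite [LHS](_ : _ = ('X_k * (z (k |: S) : R))@_(a - mesym1 S)) // mcoeffXUM.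
  rewrite scale1r /strand mesym1U1 // mnmBE mem_mesym1 (negPf kS) subn0 submDA.
  congr (if _ then _ else _); apply/idP/mnm_lepP => [ak i|/(_ k)].
    have := mnm_lepP Sa i; rewrite mnmDE mnm1E; case: eqP => [<-|_].
      by rewrite mem_mesym1 (negPf kS) add0n lt0n.
    by rewrite addn0.
  by rewrite mnmDE mnm1E eqxx mem_mesym1 (negPf kS) add0n lt0n.
by rewrite -E; case: sb; rewrite //= raddfN.
Qed.

Lemma strands_exact P z :
    (forall a, exists c, (forall S, c S != 0 -> (mesym1 S <= a)%MM /\ P (a - mesym1 S)%MM) /\
       forall S, (mesym1 S <= a)%MM -> strand a z S = dl (fun=> 1) c S) ->
  exists w, (forall S, mono P (w S)) /\ forall S, z S = dl xs w S.
Proof.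
move=> /choice_fun[c0 hc0].
pose M := (\max_(S : {set 'I_n}) msize (z S : R))%N.
(* The coefficients of [z] have degree below [M] and sets have at most [n] elements, so [z] has no
   component of total degree [M + n] or more. *)
pose c a S : K^o := if (mdeg a < M + n)%N then c0 a S else 0.
have hc a S : c a S != 0 -> (mesym1 S <= a)%MM /\ P (a - mesym1 S)%MM.
  rewrite /c; case: ifP => _; last by rewrite eqxx.
  exact: (hc0 a).1.
pose w S : R^o := mtrunc (M + n) (fun m => c (m + mesym1 S)%MM S).
have hw S m : (w S : R)@_m = c (m + mesym1 S)%MM S.
  rewrite mcoeff_mtrunc; case: ltnP => // h; rewrite /c ltnNge.
  by rewrite mdegD (leq_trans h) ?leq_addr.
have sw a S : strand a w S = c a S.
  rewrite /strand; case: ifP => [Sa|Sa]; first by rewrite hw submK.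
  by apply/esym/eqP; apply: contraFT Sa => /hc[].
exists w; split=> S; first by move=> m; rewrite hw => /hc[_]; rewrite addmK.
apply/mpolyP => m; rewrite -[m in RHS](addmK (mesym1 S)) strand_dl ?lem_addl //.
rewrite (eq_dl _ (c' := c (m + mesym1 S)%MM)) => [|k _]; last exact: sw.
rewrite /c; case: ltnP => h.
  by rewrite -(hc0 _).2 /strand ?lem_addl // addmK.
rewrite [RHS]big1 => [|k _]; last by rewrite scaler0 sv0.
apply: memN_msupp_eq0; apply: msize_mdeg_ge.
apply: (@leq_trans M); first exact: (leq_bigmax (F := fun S => msize (z S : R))).
rewrite -(leq_add2r n) (leq_trans h) // mdegD leq_add2l mdeg_mesym1.
by rewrite -[X in (_ <= X)%N]card_ord max_card.
Qed.

(** If [a] involves [x_k], the vertex [k] can always be added, so the strand is a cone with apex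
    [k]. Monomials of the preimage become monomials of [z] after multiplication by [x_k]. *)
Lemma strand_create Q a z k : (forall S, mono Q (z S)) -> (forall S, dl xs z S = 0) ->
    a k != 0%N ->
  (forall S, create k (strand a z) S != 0 ->
     (mesym1 S <= a)%MM /\ Q (a - mesym1 S + U_(k))%MM) /\
  forall S, (mesym1 S <= a)%MM -> strand a z S = dl (fun=> 1) (create k (strand a z)) S.
Proof.
move=> Qz z0 ak; split=> S.
  rewrite /create; case: ifP => kS; last by rewrite eqxx.
  rewrite /strand; case: ifP => [Sa|_]; last by rewrite sv0 eqxx.
  have Sa' : (mesym1 S <= a)%MM.
    apply/mnm_lepP => i; have := mnm_lepP Sa i; rewrite !mem_mesym1 !inE.
    by case: eqP => [->|_] //=; rewrite kS lt0n.
  move=> h; split=> //; have : (z (S :\ k) : R)@_(a - mesym1 (S :\ k)) != 0.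
    by apply: contraNneq h => ->; rewrite sv0.
  move/Qz; congr (Q _).
  apply: (@addIm _ (mesym1 (S :\ k))); rewrite submK // -addmA [(U_(k) + _)%MM]addmC.
  by rewrite -mesym1D1 // submK.
move=> Sa; have := dl_create (fun=> 1) k (strand a z) S.
rewrite scale1r => <-; rewrite [X in _ + X](_ : _ = 0) ?addr0 // /create.
case: ifP => // kS; have Sa' : (mesym1 (S :\ k) <= a)%MM.
  by apply: lepm_trans Sa; rewrite [X in (_ <= X)%MM](mesym1D1 kS) lem_addr.
by rewrite -strand_dl // z0 mcoeff0 sv0.
Qed.

(** Acyclicity of the Koszul complex of the polynomial ring: every nonzero multidegree has a
    variable to contract with, and multidegree 0 is excluded by the condition on [z set0]. *)
Lemma koszul_free P Q z :
    (forall m k, Q (m + U_(k))%MM -> P m) -> (forall S, mono Q (z S)) ->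
    (z set0 : R)@_0%MM = 0 -> (forall S, dl xs z S = 0) ->
  exists w, (forall S, mono P (w S)) /\ forall S, z S = dl xs w S.
Proof.
move=> QP Qz z00 z0; apply: strands_exact => a.
have [->|] := eqVneq a 0%MM.
  exists (fun=> 0); split=> S; first by rewrite eqxx.
  move=> S0; have -> : S = set0.
    apply/setP => i; rewrite inE; have := mnm_lepP S0 i.
    by rewrite mem_mesym1 mnm0E; case: (i \in S).
  rewrite /strand mesym1_set0 lepm_refl subm0 z00 /dl big1 // => k _.
  by rewrite scaler0 sv0.
rewrite -mdeg_eq0 mdegE sum_nat_eq0 negb_forall => /existsP[k /= ak].
have [h1 h2] := strand_create Qz z0 ak.
by exists (create k (strand a z)); split=> // S /h1[Sa /QP].
Qed.

Lemma koszul_free_row q P Q (z : {set 'I_n} -> 'rV[R]_q) :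
    (forall m k, Q (m + U_(k))%MM -> P m) -> (forall S j, mono Q (z S 0 j)) ->
    (forall j, (z set0 0 j)@_0%MM = 0) -> (forall S, dl xs z S = 0) ->
  exists w : {set 'I_n} -> 'rV[R]_q, (forall S j, mono P (w S 0 j)) /\ forall S, z S = dl xs w S.
Proof.
move=> QP Qz z00 z0.
have dlE (w : {set 'I_n} -> 'rV[R]_q) j S :
    dl xs w S 0 j = dl xs (fun T => w T 0 j : R^o) S.
  rewrite /dl summxE; apply: eq_bigr => k _.
  by case: sb; rewrite /= !mxE.
have /choice_fun[w hw] : forall j, exists w, (forall S, mono P (w S)) /\
    forall S, z S 0 j = dl xs w S.
  by move=> j; apply: (koszul_free QP) => // S; rewrite -dlE z0 mxE.
exists (fun S => \row_j w j S); split=> S; first by move=> j; rewrite mxE; apply: (hw j).1.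
apply/rowP => j; rewrite dlE (hw j).2; apply: (@eq_dl R R^o n xs) => k _.
by rewrite mxE.
Qed.

(* Comparison of the signs of the chain complex of a link with those of the
   complex of faces containing [F]. *)
Definition et F S : bool := odd #|[set k in S | sb k F]|.

Definition tw F (b : {set 'I_n} -> K^o) S : K^o :=
  if [disjoint S & F] then sv (et F S) (b (S :|: F)) else 0.

Lemma sb_setU F S k : [disjoint S & F] -> sb k (S :|: F) = sb k S (+) sb k F.
Proof.
move=> dis; rewrite /sb -oddD; congr odd.
rewrite -cardsUI [X in (_ + X)%N](_ : _ = 0%N) ?addn0.
  by apply: eq_card => i; rewrite !inE andb_orl.
apply/eqP; rewrite cards_eq0 -subset0; apply/subsetP => i.
rewrite !inE => /andP[/andP[iS _] /andP[iF _]].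
by have /pred0P/(_ i) := dis; rewrite /= iS iF.
Qed.

Lemma etU1 F S k : k \notin S -> et F (k |: S) = sb k F (+) et F S.
Proof.
move=> kS; rewrite /et; case hk: (sb k F).
  have -> : [set i in k |: S | sb i F] = k |: [set i in S | sb i F].
    by apply/setP => i; rewrite !inE; case: eqP => [->|]; rewrite //= hk.
  by rewrite cardsU1 inE (negPf kS).
congr odd; apply: eq_card => i; rewrite !inE.
by case: eqP => [->|]; rewrite //= hk !andbF.
Qed.

Lemma disjoint_setU1 F S k : [disjoint k |: S & F] = (k \notin F) && [disjoint S & F].
Proof. by rewrite -!setI_eq0 setIUl setU_eq0 setI_eq0 disjoints1. Qed.

Lemma dl_tw F b S : [disjoint S & F] ->
  dl (fun=> 1) (tw F b) S = sv (et F S) (dl (fun=> 1) b (S :|: F)).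
Proof.
move=> dis; rewrite /dl sv_sum [RHS]big_mkcond [LHS]big_mkcond /=.
apply: eq_bigr => k _; rewrite inE negb_or; case: ifP => //= kS.
rewrite !scale1r /tw disjoint_setU1 dis andbT; case: ifPn => kF; last exact: sv0.
by rewrite etU1 // sb_setU // !sv_sv setUA addbA addbC addbA.
Qed.

End Strands.

(** * Koszul homology of the cover ideal *)

Section CoverKoszul.

Variables (K : fieldType) (n : nat) (e : rel 'I_n).
Local Notation R := {mpoly K[n]}.
Local Notation d := (n - alpha0 e)%N.
Implicit Types (S T F : {set 'I_n}) (a m : 'X_{1..n}) (k : 'I_n).

Definition covered m := vertex_cover e (supp m).

Lemma chexact_total F (c : {set 'I_n} -> K^o) : chexact K (indep e) d ->
    (forall S, ~~ indep e S -> c S = 0) -> (forall S, (d <= #|S|)%N -> c S = 0) ->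
    (forall S, F \subset S -> dl (fun=> 1) c S = 0) ->
  exists b, (forall S, ~~ indep e S -> b S = 0) /\
    forall S, F \subset S -> c S = dl (fun=> 1) b S.
Proof.
move=> ex c0 cd hc.
have /choice_fun[b hb] : forall q, exists b, (forall S, ~~ indep e S -> b S = 0) /\
    forall S, F \subset S -> #|S| = q -> c S = dl (fun=> 1) b S.
  move=> q; have [dq|qd] := leqP d q.
    exists (fun=> 0); split=> // S _ cS; rewrite cd ?cS //.
    by rewrite /dl big1 // => k _; rewrite scaler0 sv0.
  have [S nS|S FS cS|b [b0 hb]] := ex F q (fun S => if #|S| == q then c S else 0) qd.
  - by rewrite c0 // if_same.
  - rewrite -[RHS](hc S FS); apply: eq_dl => k kS.
    by rewrite cardsU1 kS add1n cS eqxx.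
  - by exists b; split=> // S FS cS; rewrite -hb // cS eqxx.
(* The boundary on sets of size [q] reads only sets of size [q.+1], so the solutions for different
   [q] do not interfere. *)
exists (fun S => b #|S|.-1 S); split=> S; first exact: (hb _).1.
move=> FS; rewrite ((hb #|S|).2 S FS erefl); apply: eq_dl => k kS.
by rewrite cardsU1 kS.
Qed.

Lemma squarefree_mnm a : (forall k, a k <= 1)%N -> a = mesym1 (supp a).
Proof.
move=> a1; apply/mnmP => i; rewrite mem_mesym1 inE.
by have := a1 i; case: (a i) => [|[]].
Qed.

Lemma mesym1D S T : S \subset T -> (mesym1 T - mesym1 S)%MM = mesym1 (T :\: S).
Proof.
move=> ST; apply/mnmP => i; rewrite mnmBE !mem_mesym1 inE.
by case: (boolP (i \in S)) => [/(subsetP ST) ->|_] //=; rewrite subn0.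
Qed.

(** Strand by strand. If [a k] is at least 2, contracting with [k] does not change supports. If [a]
    is squarefree with support [s], the monomial on [s :\: S] lies in the cover ideal exactly when
    [S :|: ~: s] is independent, which gives the link of [~: s]; degree above [alpha0 e] means size
    below [d]. *)
Lemma cover_koszul (z : {set 'I_n} -> R^o) : chexact K (indep e) d ->
    (forall S, mono covered (z S)) ->
    (forall S, mono (fun m => alpha0 e < mdeg m)%N (z S)) ->
    (forall S, dl (@xs K n) z S = 0) ->
  exists w : {set 'I_n} -> R^o, (forall S, mono covered (w S)) /\ forall S, z S = dl (@xs K n) w S.
Proof.
move=> ex zc za z0; apply: strands_exact => a.
have [/existsP[k ak]|] := boolP [exists k, 1 < a k]%N.
  have [h1 h2] := strand_create zc z0 (lt0n_neq0 (ltnW ak)).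
  exists (create k (strand a z)); split=> // S /h1[Sa h]; split=> //.
  rewrite /covered; apply: vertex_coverS h; rewrite suppD subUset subxx /=.
  apply/subsetP => i; rewrite !inE mnm1E; have [<- _|] := eqVneq k i; last by [].
  rewrite mnmBE mem_mesym1 subn_eq0 -ltnNge.
  by apply: leq_ltn_trans ak; apply: leq_b1.
rewrite negb_exists => /forallP a1.
have {a1} ea : a = mesym1 (supp a).
  by apply: squarefree_mnm => k; rewrite leqNgt.
set s := supp a in ea; pose F := ~: s; pose st := strand a z.
have leS S : (mesym1 S <= a)%MM = (S \subset s) by rewrite mesym1_le.
have stc S : st S != 0 -> [/\ S \subset s, indep e (S :|: F) & (#|S :|: F| < d)%N].
  rewrite /st /strand leS; case: ifP => // Ss; last by rewrite eqxx.
  rewrite {1}ea mesym1D // => h; have eSF : s :\: S = ~: (S :|: F).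
    by rewrite setCU setCK setDE setIC.
  split=> //; first by have := zc S _ h; rewrite /covered supp_mesym1 eSF.
  have := za S _ h; rewrite mdeg_mesym1 eSF.
  have := cardsC (S :|: F); rewrite card_ord; lia.
have Fdis S : [disjoint S & F] = (S \subset s) by rewrite disjoints_subset setCK.
pose C T : K^o := if F \subset T then sv (et F (T :\: F)) (st (T :\: F)) else 0.
have subD T : F \subset T -> T :\: F :|: F = T.
  by move=> FT; rewrite setUC setDE setUIr setUCr setIT; apply/setUidPr.
have disD S : S \subset s -> (S :|: F) :\: F = S.
  by rewrite -Fdis setDUl setDv setU0 => /setDidPl.
have twC S : tw F C S = st S.
  rewrite /tw Fdis; case: ifPn => Ss; last first.
    by rewrite /st /strand leS (negPf Ss).
  by rewrite /C subsetUr disD // svK.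
have stdl S : S \subset s -> dl (fun=> 1) st S = 0.
  by move=> Ss; rewrite -strand_dl ?leS // z0 mcoeff0.
have [T nT|T dT|T FT|b [b0 hb]] := @chexact_total F C ex.
- rewrite /C; case: ifP => // FT; have [->|/stc[_]] := eqVneq (st (T :\: F)) 0.
    by rewrite sv0.
  by rewrite subD // (negPf nT).
- rewrite /C; case: ifP => // FT; have [->|/stc[_ _]] := eqVneq (st (T :\: F)) 0.
    by rewrite sv0.
  by rewrite subD // ltnNge dT.
- have Ts : T :\: F \subset s by rewrite setDE setCK subsetIr.
  have := @dl_tw K n F C (T :\: F); rewrite Fdis Ts subD // => /(_ isT) h.
  apply: (can_inj (svK (et F (T :\: F)))); rewrite -h sv0.
  by rewrite -(stdl _ Ts); apply: eq_dl => k _; rewrite twC.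
exists (tw F b); split=> S.
  rewrite /tw Fdis leS; case: ifP => [Ss|]; last by rewrite eqxx.
  move=> h; split=> //; rewrite {1}ea mesym1D // /covered supp_mesym1.
  have -> : s :\: S = ~: (S :|: F) by rewrite setCU setCK setDE setIC.
  apply: contraNT h => /b0 ->; by rewrite sv0.
rewrite leS => Ss; rewrite dl_tw ?Fdis // -hb ?subsetUr //.
by rewrite /C subsetUr disD // svK.
Qed.

End CoverKoszul.

(** * Modules with a linear resolution *)

Section LinearModules.

Variables (K : fieldType) (n : nat).
Local Notation R := {mpoly K[n]}.
Local Notation xs := (@xs K n).
Implicit Types (S T : {set 'I_n}) (m : 'X_{1..n}).

Definition homrow q (t : nat) (v : 'rV[R]_q) : Prop :=
  forall j, mono (fun m => mdeg m == t) (v 0 j).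

Definition hcr q (d s : nat) (v : 'rV[R]_q) : 'rV[R]_q := map_mx (hc d s) v.

Fact hcr_is_additive q d s : additive (@hcr q d s).
Proof. by move=> u v; apply/rowP => j; rewrite !mxE linearB. Qed.
HB.instance Definition _ q d s :=
  GRing.isAdditive.Build _ _ (@hcr q d s) (@hcr_is_additive q d s).

Lemma hc_shift d s k (f : R) : hc (k + d) (k + s) f = hc d s f.
Proof.
by apply/mpolyP => m; rewrite !mcoeff_hc addnCA eqn_add2l.
Qed.

Lemma homrow_hcr q t (v : 'rV[R]_q) : homrow t (hcr t 0 v).
Proof. by move=> j m; rewrite mxE mcoeff_hc addn0; case: ifP; rewrite ?eqxx. Qed.

Lemma hcr_homrow q t (v : 'rV[R]_q) : homrow t v -> hcr t 0 v = v.
Proof.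
move=> hv; apply/rowP => j; rewrite mxE; apply: mpart_mono.
by apply: eq_mono (hv j) => m; rewrite addn0.
Qed.

Lemma sum_hcr q (v : 'rV[R]_q) : exists N, v = \sum_(d < N) hcr d 0 v.
Proof.
pose N := (\max_j msize (v 0%R j))%N; exists N; apply/rowP => j; rewrite summxE.
apply/mpolyP => m; rewrite raddf_sum /=.
under eq_bigr => d _ do rewrite mxE mcoeff_hc addn0.
have [mN|Nm] := ltnP (mdeg m) N.
  rewrite (bigD1 (Ordinal mN)) //= eqxx big1 ?addr0 // => d.
  by rewrite -val_eqE /= eq_sym => /negPf ->.
rewrite big1 => [|d _]; last by rewrite gtn_eqF // (leq_trans _ Nm).
apply: memN_msupp_eq0; apply: msize_mdeg_ge; apply: leq_trans Nm.
exact: (leq_bigmax (F := fun j => msize (v 0 j))).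
Qed.

Lemma hcr_mulmx p q a d (v : 'rV[R]_p) (D : 'M[R]_(p, q)) :
    (forall k l, mono (fun m => mdeg m == a) (D k l)) ->
  hcr (a + d) 0 (v *m D) = hcr d 0 v *m D.
Proof.
move=> hD; apply/rowP => j; rewrite !mxE linear_sum; apply: eq_bigr => k _.
by rewrite mxE [v 0 k * _]mulrC [RHS]mulrC -(hc_shift d 0 a) -(hc_mul _ _ _ (hD k j)).
Qed.

Lemma hcr_scaleX q d (k : 'I_n) (v : 'rV[R]_q) :
  hcr d.+1 0 (xs k *: v) = xs k *: hcr d 0 v.
Proof.
have hk : mono (fun m => mdeg m == 1)%N (xs k) by apply/monoXm; rewrite mdeg1.
by apply/rowP => j; rewrite !mxE (hc_mul _ _ _ hk) -(hc_shift d 0 1).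
Qed.

(* [Z] lives in degrees at least [a] and has a linear resolution starting in
   degree [a], expressed by the vanishing of its Koszul homology. *)
Definition linmod q (Z : 'rV[R]_q -> Prop) (a : nat) : Prop :=
  [/\ submod Z, forall t v, Z v -> Z (hcr t 0 v),
      forall v j, Z v -> mono (fun m => a <= mdeg m)%N (v 0 j) &
      forall z, (forall S, Z (z S)) ->
        (forall S j, mono (fun m => a < mdeg m)%N (z S 0 j)) ->
        (forall S, dl xs z S = 0) ->
        exists w, (forall S, Z (w S)) /\ forall S, z S = dl xs w S].

Definition scalars r (c : 'rV[K]_r) : 'rV[R]_r := map_mx (@mpolyC n K) c.

(** A [K]-basis of the degree [a] part of [Z], grown one row at a time. The coefficients of such
    rows are indexed by the finite type [Y], whose cardinality bounds the growth. *)
Lemma degree_basis q (Z : 'rV[R]_q -> Prop) a :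
  exists r (D : 'M[R]_(r, q)), [/\ forall k, Z (row k D) /\ homrow a (row k D),
    forall c, scalars c *m D = 0 -> c = 0 &
    forall v, Z v -> homrow a v -> exists c, v = scalars c *m D].
Proof.
pose Y := ('I_q * 'X_{1..n < a.+1})%type.
have dep r (D : 'M[R]_(r, q)) : (#|{: Y}| < r)%N -> (forall k, homrow a (row k D)) ->
    exists2 c, c != 0 & scalars c *m D = 0.
  move=> Yr hD; pose E := \matrix_(k < r, y < #|{: Y}|)
    (D k (enum_val y).1)@_(bmnm (enum_val y).2).
  have [c c0 cE] := left_kernel_neq0 E Yr; exists c => //.
  apply/rowP => j; apply/mpolyP => m; rewrite !mxE mcoeff0 raddf_sum /=.
  have [ma|am] := leqP (mdeg m) a; last first.
    apply: big1 => k _; rewrite mxE mcoeffCM; apply/eqP; rewrite mulf_eq0.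
    apply/orP; right; apply: contraTT am => h; have := hD k j m.
    by rewrite mxE => /(_ h) /eqP ->; rewrite ltnn.
  have /rowP/(_ (enum_rank ((j, BMultinom (ma : mdeg m < a.+1)%N) : Y))) := cE.
  rewrite !mxE => h; rewrite -[RHS]h; apply: eq_bigr => k _.
  by rewrite !mxE mcoeffCM enum_rankK.
suff grow k r (D : 'M[R]_(r, q)) : (#|{: Y}| < r + k)%N ->
    (forall k, Z (row k D) /\ homrow a (row k D)) ->
    (forall c, scalars c *m D = 0 -> c = 0) ->
  exists r (D : 'M[R]_(r, q)), [/\ forall k, Z (row k D) /\ homrow a (row k D),
    forall c, scalars c *m D = 0 -> c = 0 &
    forall v, Z v -> homrow a v -> exists c, v = scalars c *m D].
  apply: (grow #|{: Y}|.+1 0%N (0 : 'M_(0, q))) => [|[]//|c _] //.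
  by apply/rowP => -[].
elim: k r D => [|k IH] r D Yk hD iD.
  rewrite addn0 in Yk; have [c c0 /iD] := dep r D Yk (fun k => (hD k).2).
  by move=> c0'; rewrite c0' eqxx in c0.
have [sp|] := excluded_middle_informative
    (forall v, Z v -> homrow a v -> exists c, v = scalars c *m D).
  by exists r, D.
move=> nsp; have [v nv0] := not_all_ex_not _ _ nsp.
have [Zv nv1] := imply_to_and _ _ nv0; have [hv nv] := imply_to_and _ _ nv1.
apply: (IH (r + 1)%N (col_mx D v)); first by rewrite addnAC -addnA addn1.
  move=> i; case: (split_ordP i) => j ->; first by rewrite rowKu.
  by rewrite rowKd (ord1 j) row_id.
move=> c; rewrite -[c]hsubmxK /scalars map_row_mx mul_row_col.
set c1 := lsubmx c; set c2 := rsubmx c => h.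
have c20 : c2 = 0.
  apply/eqP; apply: contra_notT nv => c2n.
  have c2v : map_mx (@mpolyC n K) c2 *m v = (c2 0 0)%:MP *: v.
    by apply/rowP => j; rewrite !mxE big_ord1 !mxE.
  have c200 : c2 0 0 != 0.
    by apply: contraNneq c2n => c0; apply/eqP/rowP => j; rewrite (ord1 j) c0 mxE.
  exists (- (c2 0 0)^-1 *: c1); rewrite c2v in h.
  have -> : scalars (- (c2 0 0)^-1 *: c1) = (- (c2 0 0)^-1)%:MP *: scalars c1.
    by apply/rowP => j; rewrite !mxE mpolyCM.
  rewrite -scalemxAl (_ : scalars c1 *m D = - ((c2 0 0)%:MP *: v)); last first.
    by apply/eqP; rewrite -addr_eq0 h.
  by rewrite scalerN mpolyCN scaleNr opprK scalerA -mpolyCM mulVf // scale1r.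
rewrite c20 map_mx0 mul0mx addr0 in h; rewrite (iD _ h) c20.
by rewrite row_mx0.
Qed.

Definition mximage p q (D : 'M[R]_(p, q)) (v : 'rV[R]_q) : Prop := exists w, v = w *m D.

Lemma submod_mximage p q (D : 'M[R]_(p, q)) : submod (mximage D).
Proof.
split=> [|u v [x ->] [y ->]|a v [x ->]]; first by exists 0; rewrite mul0mx.
  by exists (x + y); rewrite mulmxDl.
by exists (a *: x); rewrite scalemxAl.
Qed.

Lemma dl_mulmx p q (D : 'M[R]_(p, q)) (y : {set 'I_n} -> 'rV[R]_p) S :
  dl xs (fun T => y T *m D) S = dl xs y S *m D.
Proof.
rewrite /dl mulmx_suml; apply: eq_bigr => k _.
by rewrite scalemxAl; case: sb; rewrite //= mulNmx.
Qed.

(** A vector of degree above [a], seen as a Koszul 0-chain, is a boundary, hence a combination of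
    elements of [Z] of lower degree; so degree [a] generates. The syzygies have no constants because
    the generators are independent over [K]. *)
Lemma linmod_generators q (Z : 'rV[R]_q -> Prop) a : linmod Z a ->
  exists r (D : 'M[R]_(r, q)), [/\ forall k l, mono (fun m => mdeg m == a) (D k l),
    forall v, Z v <-> exists w, v = w *m D & linmod (fun v : 'rV[R]_r => v *m D = 0) 1].
Proof.
move=> [sZ hZ lowZ kZ]; have [r [D [hD iD spD]]] := degree_basis Z a.
have hD' k l : mono (fun m => mdeg m == a) (D k l).
  by have := (hD k).2 l; rewrite mxE.
have imZ w : Z (w *m D).
  rewrite mulmx_sum_row; apply: submod_sum => // k _.
  by case: sZ => _ _; apply; apply: (hD k).1.
have small t v : (t <= a)%N -> Z v -> homrow t v -> mximage D v.
  rewrite leq_eqVlt => /orP[/eqP->|ta] Zv hv.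
    by have [c ->] := spD v Zv hv; exists (scalars c).
  exists 0; rewrite mul0mx; apply/rowP => j; apply/mpolyP => m; rewrite mxE mcoeff0.
  apply/eqP; apply: contraTT ta => h; rewrite -leqNgt.
  by rewrite -(eqP (hv j m h)) (lowZ v j Zv m h).
have Zhom t v : Z v -> homrow t v -> mximage D v.
  elim: t v => [|t IH] v Zv hv; first exact: small hv.
  have [ta|at'] := leqP t.+1 a; first exact: small hv.
  pose z S := if S == set0 then v else 0.
  have [S|S j|S|w [Zw zw]] := kZ z.
  - by rewrite /z; case: ifP => // _; case: sZ.
  - rewrite /z; case: ifP => _; last by rewrite mxE; apply: mono0.
    by apply: sub_mono (hv j) => m /eqP ->.
  - rewrite /dl big1 // => k _; rewrite /z ifN ?scaler0 ?sv0 //.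
    by apply/set0Pn; exists k; rewrite setU11.
  rewrite -(hcr_homrow hv); have := zw set0; rewrite /z eqxx => ->.
  rewrite /dl raddf_sum; apply: (@submod_sum _ _ (mximage D)) => [|k _]; first exact: submod_mximage.
  have sI := submod_mximage D.
  have E : hcr t.+1 0 (sv (sb k set0) (xs k *: w (k |: set0))) =
      sv (sb k set0) (xs k *: hcr t 0 (w (k |: set0))).
    by rewrite -hcr_scaleX; case: sb; rewrite //= raddfN.
  suff : mximage D (sv (sb k set0) (xs k *: hcr t 0 (w (k |: set0)))) by rewrite -E.
  apply: (@submod_sv _ _ (mximage D)) => //; case: (sI) => _ _; apply.
  by apply: IH; [exact: hZ|exact: homrow_hcr].
exists r, D; split=> // [v|].
  split=> [Zv|[w ->] //]; have [N ->] := sum_hcr v.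
  apply: (@submod_sum _ _ (mximage D)) => [|t _]; first exact: submod_mximage.
  by apply: (Zhom t); [exact: hZ|exact: homrow_hcr].
split=> [|t v vD|v j vD|z zD zdeg z0].
- split=> [|u v uD vD|c v vD]; first by rewrite mul0mx.
    by rewrite mulmxDl uD vD addr0.
  by rewrite -scalemxAl vD scaler0.
- by rewrite -(hcr_mulmx _ _ hD') vD raddf0.
- have c0 : hcr 0 0 v = scalars (\row_j (v 0 j)@_0%MM).
    apply/rowP => i; rewrite !mxE; apply/mpolyP => m.
    by rewrite mcoeff_hc mcoeffC addn0 mdeg_eq0; case: eqP => [->|]; rewrite ?mulr1 ?mulr0.
  have /rowP/(_ j) : \row_j (v 0 j)@_0%MM = 0 :> 'rV[K]_r.
    by apply: iD; rewrite -c0 -(hcr_mulmx _ _ hD') vD raddf0.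
  rewrite !mxE => v0 m; apply: contraNT; rewrite -leqNgt leqn0 mdeg_eq0.
  by move=> /eqP ->; rewrite v0.
(* Dimension shift: [z] bounds [y] in the free module, [y *m D] is a cycle in [Z] above the linear
   degree and bounds some [u *m D], and [y - dl xs u] is a preimage of [z] inside the kernel. *)
have [m k|S j|j|//|y [ydeg zy]] := @koszul_free_row K n r
    (fun m => 1 <= mdeg m)%N (fun m => 1 < mdeg m)%N z.
- by rewrite mdegD mdeg1 addn1 ltnS.
- exact: zdeg.
- apply/eqP; apply: contraTT isT => /zdeg; by rewrite mdeg0.
have [S|S j|S|w [Zw hw]] := kZ (fun S => y S *m D).
- exact: imZ.
- rewrite mxE; apply: mono_sum => k _; apply: (mono2M _ (ydeg S k) (hD' k j)).
  by move=> m m' m1 /eqP <-; rewrite mdegD -add1n leq_add2r.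
- by rewrite dl_mulmx -zy zD.
have /choice_fun[u hu] : forall S, exists u, w S = u *m D.
  move=> S; have [N ->] := sum_hcr (w S).
  apply: (@submod_sum _ _ (mximage D)) => [|t _]; first exact: submod_mximage.
  by apply: (Zhom t); [exact: hZ|exact: homrow_hcr].
exists (fun S => y S - dl xs u S); split=> S; last by rewrite dlB dl_dl subr0.
rewrite mulmxBl hw -dl_mulmx -(eq_dl _ (c := w)) ?subrr // => k _; exact: hu.
Qed.

End LinearModules.

(** * The linear resolution of the cover ideal *)

Section LinearResolution.

Variables (K : fieldType) (n : nat) (e : rel 'I_n).
Hypothesis e_edge : exists i j, e i j.
Local Notation R := {mpoly K[n]}.
Local Notation xs := (@xs K n).
Local Notation J := (cover_ideal K e).
Local Notation d := (n - alpha0 e)%N.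

Lemma cover_linmod : chexact K (indep e) d ->
  linmod (fun v : 'rV[R]_1 => J (v 0 0)) (alpha0 e).
Proof.
move=> ex; have JE f : J f <-> mono (covered e) f by exact: cover_idealE.
split=> [|t v /JE h|v j /JE h m hm|z /(_ _)/JE zJ zdeg z0].
- split=> [|u v /JE hu /JE hv|a v /JE hv]; rewrite !mxE; apply/JE; first exact: mono0.
    exact: monoD.
  apply: monoMr hv => a' b; rewrite /covered suppD => h.
  by apply: vertex_coverS h; apply: subsetUr.
- by rewrite mxE; apply/JE; apply: mono_mpartI.
- rewrite (ord1 j) in hm; apply: leq_trans (card_supp_le m).
  by apply: alpha0_min; apply: h.
have dlE (w : {set 'I_n} -> 'rV[R]_1) S :
    dl xs w S 0 0 = dl xs (fun T => w T 0 0 : R^o) S.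
  rewrite /dl summxE; apply: eq_bigr => k _.
  by case: sb; rewrite /= !mxE.
have [|S|w [wJ hw]] := @cover_koszul K n e (fun S => z S 0 0) ex zJ.
- by move=> S; apply: zdeg.
- by rewrite -dlE z0 mxE.
exists (fun S => const_mx (w S)); split=> S; first by rewrite mxE; apply/JE.
apply/rowP => j; rewrite (ord1 j) dlE hw; apply: (@eq_dl R R^o n xs) => k _.
by rewrite mxE.
Qed.

Record stage := Stage { st_rows : nat; st_cols : nat; st_mx : 'M[R]_(st_rows, st_cols) }.

Definition kerlin (s : stage) : Prop :=
  linmod (fun v : 'rV[R]_(st_rows s) => v *m st_mx s = 0) 1.

Definition covers (s : stage) (r : nat) (D : 'M[R]_(r, st_rows s)) : Prop :=
  [/\ forall k l, mono (fun m => mdeg m == 1)%N (D k l),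
    forall v : 'rV[R]_(st_rows s), v *m st_mx s = 0 <-> exists w, v = w *m D &
    linmod (fun v : 'rV[R]_r => v *m D = 0) 1].

(** The hypothesis stands under the existential so that choice gives a total function, which allows
    plain recursion before any stage is known to be linear. *)
Lemma next_exists (s : stage) :
  exists D : {r & 'M[R]_(r, st_rows s)}, kerlin s -> covers (projT2 D).
Proof.
have [ks|nks] := excluded_middle_informative (kerlin s).
  by have [r [D hD]] := linmod_generators ks; exists (existT _ r D).
by exists (existT _ 0%N (0 : 'M[R]_(0, st_rows s))).
Qed.

Definition next_mx (s : stage) : {r & 'M[R]_(r, st_rows s)} :=
  proj1_sig (constructive_indefinite_description _ (next_exists s)).

Definition next (s : stage) : stage :=
  Stage (projT2 (next_mx s)).

Lemma next_covers s : kerlin s -> covers (st_mx (next s) : 'M_(_, st_rows s)).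
Proof. by rewrite /= /next_mx; case: constructive_indefinite_description. Qed.

Section FromGenerators.

Variables (r0 : nat) (D0 : 'M[R]_(r0, 1)).

Fixpoint stages (i : nat) : stage := if i is i'.+1 then next (stages i') else Stage D0.

(** [st_cols (next s)] is convertible to [st_rows s], so consecutive stages compose without casts.
    The module in position 0 is [R], and the generators of the ideal sit in position 1, whence [i']
    in the shifts. *)
Definition linear_resolution : free_complex K n :=
  @FreeComplex K n (fun i => st_cols (stages i))
    (fun i _ => if i is i'.+1 then alpha0 e + i' else 0)%N
    (fun i => st_mx (stages i)) (const_mx 1 : 'cV_(st_cols (stages 0))).

Hypothesis D0_deg : forall k l, mono (fun m => mdeg m == alpha0 e) (D0 k l).
Hypothesis D0_gen : forall v : 'rV[R]_1, J (v 0 0) <-> exists w, v = w *m D0.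
Hypothesis D0_lin : linmod (fun v : 'rV[R]_r0 => v *m D0 = 0) 1.

Lemma stages_kerlin i : kerlin (stages i).
Proof. by elim: i => // i /next_covers[]. Qed.

Lemma stages_deg i k l :
  mono (fun m => mdeg m == if i is 0 then alpha0 e else 1)%N (st_mx (stages i) k l).
Proof.
case: i k l => [|i] k l; first exact: D0_deg.
by case: (next_covers (stages_kerlin i)).
Qed.

Lemma linear_resolution_minimal :
  minimal_graded_free_resolution linear_resolution J.
Proof.
have a0 : (0 < alpha0 e)%N by case: e_edge => i [j] /alpha0_gt0.
split.
- split=> [i k l m|k] /=.
    rewrite mcoeff_msupp => /stages_deg/eqP ->.
    by case: i k l => [|i] k l; rewrite ?addn0 // addnCA add1n addnS.
  rewrite mxE; apply/dhomogP => m; rewrite msupp1 inE => /eqP ->.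
  exact: mdeg0.
- have aug (v : 'rV[R]_1) : (v *m fc_aug linear_resolution) 0 0 = v 0 0.
    by rewrite mxE big_ord1 mxE mulr1.
  have JI : is_ideal J by exact: ideal_gen_is_ideal.
  split=> [f|v|i v] /=.
  + exists (const_mx f); rewrite aug mxE subrr; by case: JI.
  + by rewrite aug.
  + by case: (next_covers (stages_kerlin i)).
move=> i k l; apply/irrelevantP; apply: (sub_mono _ (@stages_deg i k l)) => m.
rewrite -mdeg_eq0 => /eqP ->; case: i k l => [|//] k l.
by rewrite -lt0n.
Qed.

Lemma linear_resolution_regularity : is_regularity J (alpha0 e - 1).
Proof.
have a0 : (0 < alpha0 e)%N by case: e_edge => i [j] /alpha0_gt0.
exists linear_resolution; split; first exact: linear_resolution_minimal.
split=> [|q [i [j []]]].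
  (* The maximum is attained at the generators; there is one because the ideal contains the monomial
     of a smallest cover. *)
  exists 1%N, (alpha0 e); split; last by rewrite addnC subnK.
  have [C [hC cC]] := alpha0_ex e.
  have /D0_gen[w hw] : J ((const_mx 'X_[mesym1 C] : 'rV[R]_1) 0 0).
    by rewrite mxE; apply/cover_idealE; apply/monoXm; rewrite supp_mesym1.
  have r0_gt0 : (0 < r0)%N.
    rewrite lt0n; apply/eqP => r00; have /rowP/(_ 0) := hw.
    rewrite !mxE big1 => [h|k _].
      have := congr1 (mcoeff (mesym1 C)) h; rewrite mcoeffX eqxx mcoeff0.
      by move/eqP; rewrite oner_eq0.
    by have := ltn_ord k; rewrite {2}r00.
  apply/eqP; rewrite -lt0n; apply/card_gt0P; exists (Ordinal r0_gt0 : 'I_r0).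
  by rewrite inE /= addn0.
move=> /eqP; rewrite -lt0n => /card_gt0P[k]; rewrite inE /= => /eqP <-.
case: i k => [|i] k h; first by rewrite add0n in h; rewrite -h.
move: h a0; lia.
Qed.

End FromGenerators.

Theorem chexact_regularity : chexact K (indep e) d -> is_regularity J (alpha0 e - 1).
Proof.
move=> /cover_linmod/linmod_generators[r [D [hD genD linD]]].
exact: linear_resolution_regularity hD genD linD.
Qed.

End LinearResolution.

(** * The v-number *)

Section VNumber.

Variables (K : fieldType) (n : nat) (e : rel 'I_n).
Hypothesis e_irr : irreflexive e.
Local Notation R := {mpoly K[n]}.
Local Notation J := (cover_ideal K e).
Local Notation d := (n - alpha0 e)%N.
Implicit Types (F G H S T : {set 'I_n}) (k : 'I_n).

Lemma prime_prod (A : comNzRingType) (P : A -> Prop) (I : finType) (f : I -> A) :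
  is_prime P -> P (\prod_i f i) -> exists i, P (f i).
Proof.
case=> _ P1 PM; elim/big_rec: _ => [/P1//|i x _ IH /PM[Pi|/IH//]].
by exists i.
Qed.

(** The product of all variables lies in the prime [P], so some [x_i] does. Then [x_i] times any
    monomial of [f] is supported on a vertex cover and has degree at least [alpha0 e]. *)
Lemma v_number_lower c (f : R) (P : R -> Prop) :
  f \is c.-homog -> is_prime P -> (forall g, colon J f g <-> P g) ->
  (alpha0 e - 1 <= c)%N.
Proof.
move=> /dhomogP hf prP fP; have [[_ _ PM] P1 _] := prP.
have JI : is_ideal J by exact: ideal_gen_is_ideal.
have /(prime_prod prP)[i /fP/cover_idealE hi] : P (\prod_(i < n) 'X_i).
  apply/fP; rewrite /colon mulrC; case: JI => _ _; apply; apply/cover_idealE.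
  rewrite (eq_bigl (fun i => i \in [set: 'I_n])) => [|i]; last by rewrite inE.
  by rewrite prod_mesym1; apply/monoXm; rewrite supp_mesym1 vertex_coverT.
have f0 : f != 0.
  apply/eqP => f0; apply: P1; apply/fP; rewrite /colon f0 mulr0.
  by case: JI.
have hm := mlead_supp f0; set m := mlead f in hm.
have := hi (m + U_(i))%MM; rewrite mcoeffXM lem_addl addmK -mcoeff_msupp.
move=> /(_ hm)/alpha0_min h; rewrite leq_subLR -(hf m hm) addnC.
by rewrite (leq_trans h) // (leq_trans (card_supp_le _)) // mdegD mdeg1.
Qed.

Lemma cod_link0 F (b : {set 'I_n} -> K^o) : cod (off K F) b F = 0.
Proof. by rewrite /cod big1 // => k kF; rewrite /off kF scale0r sv0. Qed.

Lemma cod_link1 F (b : {set 'I_n} -> K^o) k : k \notin F ->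
  cod (off K F) b (k |: F) = sv (sb k F) (b F).
Proof.
move=> kF; rewrite /cod (bigD1 k) ?setU11 //= big1 ?addr0.
  by rewrite setU1K // /off kF scale1r.
move=> i; rewrite !inE => /andP[/orP[/eqP->|iF] ik]; first by rewrite eqxx in ik.
by rewrite /off iF scale0r sv0.
Qed.

Hypothesis ex : coexact K (indep e) d.

(** Purity of the complex: if [F] were maximal with fewer than [d] elements, its indicator would be
    a nonzero cocycle at the bottom of its link, where coboundaries vanish. *)
Lemma indep_extends F : indep e F -> exists G, [/\ F \subset G, indep e G & #|G| = d].
Proof.
have [r] := ubnP (d - #|F|)%N; elim: r F => // r IH F rF iF.
have [dF|Fd] := leqP d #|F|.
  by exists F; split=> //; apply/eqP; rewrite eqn_leq indep_card.
have [/existsP[k /andP[kF ik]]|nk] := boolP [exists k, (k \notin F) && indep e (k |: F)].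
  have [|G [kG iG cG]] := IH (k |: F) _ ik.
    rewrite cardsU1 kF; move: rF Fd; clear; lia.
  by exists G; split=> //; apply: subset_trans kG; apply: subsetUr.
have [S FS cS iS|b hb] := ex (F := F) (c := fun S => (S == F)%:R) Fd.
  case/existsP: nk; have /card_gt0P[k] : (0 < #|S :\: F|)%N.
    by rewrite cardsD (setIidPr FS) cS subSnn.
  rewrite inE => /andP[kF kS]; exists k; rewrite kF.
  by apply: indepS iS; rewrite subUset sub1set kS.
have := hb F (subxx _) erefl iF; rewrite eqxx cod_link0 => /eqP.
by rewrite oner_eq0.
Qed.

(* If two facets met in too small a set [F], with [F] as large as possible, then
   the link of [F] would be disconnected. *)
Lemma adjacent_facets i0 j0 : e i0 j0 -> exists G H,
  [/\ indep e G, indep e H, #|G| = d, #|H| = d & #|G :&: H|.+1 = d].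
Proof.
move=> eij; have ind1 i : indep e [set i].
  by apply/indepP => a b; rewrite !inE => /eqP -> /eqP ->; rewrite e_irr.
have [G0 [iG0 indG0 cG0]] := indep_extends (ind1 i0).
have [H0 [jH0 indH0 cH0]] := indep_extends (ind1 j0).
rewrite !sub1set in iG0 jH0.
pose P (p : {set 'I_n} * {set 'I_n}) :=
  [&& indep e p.1, indep e p.2, #|p.1| == d, #|p.2| == d & p.1 != p.2].
(* The edge provides two distinct facets: no independent set contains both of its ends. *)
have P0 : P (G0, H0).
  rewrite /P /= indG0 indH0 cG0 cH0 !eqxx /=; apply/eqP => GH.
  by have /indepP/(_ i0 j0 iG0) := indG0; rewrite GH eij => /(_ jH0).
have [[G H] /and5P[/= iG iH /eqP cG /eqP cH GH] maxGH] :=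
  arg_maxnP (fun p => #|p.1 :&: p.2|) P0.
exists G, H; split=> //; set F := G :&: H in maxGH *.
have FG : F \subset G by apply: subsetIl.
have FH : F \subset H by apply: subsetIr.
have ltF : (#|F| < d)%N.
  rewrite -cG; apply: proper_card; rewrite properEneq FG andbT.
  apply: contra GH => /eqP FeG; rewrite eqEcard cG cH leqnn andbT -FeG.
  exact: FH.
apply/eqP; rewrite eqn_leq ltF leqNgt; apply/negP => qd.
pose b0 S : K^o := (S == F)%:R.
(* Up to sign, the indicator of the vertices of the link that lie in [G]. It is a cocycle: an edge
   of the link leaving [G] would extend to a facet meeting [G] in more than [#|F|] elements. *)
pose c S : K^o := if S \subset G then cod (off K F) b0 S else 0.
have [S FS cS iS|b hb] := ex (F := F) (c := c) qd.
  have [SG|nSG] := boolP (S \subset G).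
    rewrite -[RHS](cod_cod (off K F) b0 S); apply: eq_cod => k kS.
    by rewrite /c (subset_trans (subD1set _ _)).
  rewrite /cod big1 // => k kS; rewrite /off.
  have [kF|kF] := boolP (k \in F); first by rewrite scale0r sv0.
  rewrite /c; case: ifP => [SkG|]; last by rewrite scaler0 sv0.
  have [H' [SH' iH' cH']] := indep_extends iS.
  have := maxGH (G, H'); rewrite /P /= iG iH' cG cH' !eqxx /=.
  have -> : G != H' by apply: contraNneq nSG => ->.
  move=> /(_ isT); rewrite leqNgt; case/negP.
  apply: (@leq_trans #|S :\ k|); first by have := cardsD1 k S; rewrite kS cS add1n => -[<-].
  by apply: subset_leq_card; rewrite subsetI SkG (subset_trans (subD1set _ _)).
(* A coboundary is constant, up to sign, on the vertices of the link, but [c] is nonzero at a vertex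
   from [G] and zero at one from [H]. *)
have hbk k : k \notin F -> indep e (k |: F) ->
    c (k |: F) = sv (sb k F) (b F).
  by move=> kF ik; rewrite hb ?cod_link1 ?subsetUr // cardsU1 kF.
have /card_gt0P[k] : (0 < #|G :\: F|)%N by rewrite cardsD (setIidPr FG) cG subn_gt0.
have /card_gt0P[l] : (0 < #|H :\: F|)%N by rewrite cardsD (setIidPr FH) cH subn_gt0.
rewrite !inE => /andP[lF lH] /andP[kF kG].
have kFG : k |: F \subset G by rewrite subUset sub1set kG.
have lFH : l |: F \subset H by rewrite subUset sub1set lH.
have := hbk k; rewrite kG /= in kF; rewrite inE kG /= kF => /(_ isT (indepS kFG iG)).
rewrite /c kFG cod_link1; last by rewrite inE kG kF.
move=> /(can_inj (svK _)); rewrite /b0 eqxx => b1.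
have := hbk l; rewrite lH andbT in lF; rewrite inE lH andbT lF.
move=> /(_ isT (indepS lFH iH)).
rewrite /c -b1; have -> : (l |: F \subset G) = false.
  by rewrite subUset sub1set (negPf lF).
by move/eqP; case: sb; rewrite /= eq_sym ?oppr_eq0 oner_eq0.
Qed.

(** For adjacent facets [G] and [H] the union has [d.+1] elements and is not independent; its only
    edge joins the two vertices of [E]. So [T :|: A] is a cover exactly when [T] meets [E], and the
    colon of the ideal by the monomial of [A] is generated by two variables. *)
Theorem coexact_v_number i0 j0 : e i0 j0 -> is_v_number J (alpha0 e - 1).
Proof.
move=> eij; split; last first.
  by move=> c [f [P [hf [prP _] fP]]]; apply: v_number_lower hf prP fP.
have [G [H [iG iH cG cH cF]]] := adjacent_facets eij.
pose A := ~: (G :|: H); pose E := (G :|: H) :\: (G :&: H).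
have cGH : #|G :|: H| = d.+1.
  by have := cardsUI G H; rewrite cG cH; move: cF; clear; lia.
have cA : #|A| = (alpha0 e - 1)%N.
  have := cardsC (G :|: H); rewrite card_ord cGH -/A.
  have := alpha0_le e; move: cF; clear; lia.
have single (X Y : {set 'I_n}) (x : 'I_n) : #|X| = d -> #|X :&: Y|.+1 = d -> x \in X -> x \notin Y ->
    forall y, y \in X -> y != x -> y \in Y.
  move=> cX cXY xX xY y yX yx; apply: contraT => yY.
  have : [set x; y] \subset X :\: Y.
    by apply/subsetP => z; rewrite !inE => /orP[]/eqP ->; rewrite ?xX ?yX ?xY ?yY.
  move/subset_leq_card; rewrite cards2 eq_sym yx cardsD cX -cXY.
  by rewrite subSnn.
have swap (X Y T : {set 'I_n}) (x : 'I_n) : indep e Y -> #|X| = d ->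
    #|X :&: Y|.+1 = d -> x \in X -> x \notin Y -> x \in T ->
    vertex_cover e (T :|: ~: (X :|: Y)).
  move=> iY cX cXY xX xY xT; apply: vertex_coverS iY; apply/subsetP => y.
  rewrite !inE => yY; have [yX|yX] := boolP (y \in X); last by rewrite (negPf yY) orbT.
  have [->|yx] := eqVneq y x; first by rewrite xT.
  by rewrite (single X Y x cX cXY xX xY y yX yx) in yY.
have coverE T : vertex_cover e (T :|: A) = ~~ [disjoint E & T].
  apply/idP/idP => [cT|].
    apply/negP => dET.
    have : ~~ indep e (G :|: H).
      by apply/negP => /indep_card; rewrite cGH ltnn.
    case/vertex_coverP=> a b eab; rewrite !inE -negb_and; apply/negP => /andP[aGH bGH].
    have aE : a \in E.
      rewrite !inE aGH andbT; apply/negP => /andP[aG aH].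
      case/orP: bGH => [bG|bH].
        by have /indepP/(_ a b aG bG) := iG; rewrite eab.
      by have /indepP/(_ a b aH bH) := iH; rewrite eab.
    have bE : b \in E.
      rewrite !inE bGH andbT; apply/negP => /andP[bG bH].
      case/orP: aGH => [aG|aH].
        by have /indepP/(_ a b aG bG) := iG; rewrite eab.
      by have /indepP/(_ a b aH bH) := iH; rewrite eab.
    have inT x : x \in E -> x \notin T :|: A.
      move=> xE; rewrite !inE negb_or (disjointFr dET xE) negbK.
      by move: xE; rewrite !inE => /andP[].
    by have /vertex_coverP/(_ a b eab) := cT; rewrite (negPf (inT a aE)) (negPf (inT b bE)).
  rewrite disjoint_sym => /pred0Pn[x /= /andP[xT]]; rewrite !inE negb_and.
  move=> /andP[nx xGH].
  have [xG|xnG] := boolP (x \in G).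
    by apply: (swap G H T x) => //; rewrite xG in nx.
  rewrite /A [G :|: H]setUC; apply: (swap H G T x) => //; first by rewrite setIC.
  by rewrite (negPf xnG) in xGH.
exists 'X_[mesym1 A], (var_ideal (K := K) E).
have fE g : colon J 'X_[mesym1 A] g <-> var_ideal (K := K) E g.
  have covA m : vertex_cover e (supp (mesym1 A + m)%MM) = ~~ [disjoint E & supp m].
    by rewrite suppD supp_mesym1 setUC coverE.
  apply: (iff_trans (cover_idealE _ _)); split=> h m.
    move=> gm; have := h (mesym1 A + m)%MM; rewrite mcoeffMX => /(_ gm).
    by rewrite covA.
  rewrite -mcoeff_msupp (perm_mem (msuppMX _ _)) => /mapP[m' gm' ->].
  by rewrite covA; apply: h; rewrite -mcoeff_msupp.
split=> //; last by split; [exact: var_ideal_prime|exists 'X_[mesym1 A]].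
by apply/dhomogP => m; rewrite msuppX inE => /eqP ->; rewrite -cA; exact: mdeg_mesym1.
Qed.

End VNumber.

(** * From regularity to links *)

Section Regularity.

Variables (K : fieldType) (n : nat).
Local Notation R := {mpoly K[n]}.
Local Notation xs := (@xs K n).
Implicit Types (S T : {set 'I_n}) (k : 'I_n).

Lemma dl_mem (V : lmodType R) (L : V -> Prop) (c : {set 'I_n} -> V) S :
  submod L -> (forall k, k \notin S -> L (c (k |: S))) -> L (dl xs c S).
Proof.
move=> sL h; apply: submod_sum => // k kS; apply: submod_sv => //.
by case: sL => _ _; apply; apply: h.
Qed.

Lemma hc_mul_shift j s s' (f g : R) :
    (forall m, g@_m != 0 -> (mdeg m + s' = s)%N) ->
  hc j s' (f * g) = hc j s f * g.
Proof.
move=> hg; rewrite mulrC [RHS]mulrC.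
apply: (@mpart_mul _ _ (fun m => mdeg m + s' == s)%N) => [m /hg/eqP//|b c /eqP <-].
by rewrite mdegD addnCA addnA.
Qed.

Variables (F : free_complex K n) (I : R -> Prop) (r : nat).
Hypothesis F_deg : degree_preserving F.
Hypothesis F_res : resolves F I.
Hypothesis F_reg : forall i (k : 'I_(fc_rank F i)), (fc_shift k <= i + r)%N.

Definition fhom i j (v : 'rV[R]_(fc_rank F i)) : Prop :=
  forall l, mono (fun m => mdeg m + fc_shift l == j)%N (v 0 l).

Definition fpart i j (v : 'rV[R]_(fc_rank F i)) : 'rV[R]_(fc_rank F i) :=
  \row_l hc j (fc_shift l) (v 0 l).

Lemma fpart_hom i j (v : 'rV[R]_(fc_rank F i)) : fhom j (fpart j v).
Proof. by move=> l; rewrite mxE; apply: mono_mpart. Qed.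

Lemma fpart_id i j (v : 'rV[R]_(fc_rank F i)) : fhom j v -> fpart j v = v.
Proof. by move=> hv; apply/rowP => l; rewrite mxE; apply: mpart_mono. Qed.

Lemma fpart_diff i j (u : 'rV[R]_(fc_rank F i.+1)) :
  fpart j (u *m fc_diff F i) = fpart j u *m fc_diff F i.
Proof.
apply/rowP => l; rewrite !mxE linear_sum; apply: eq_bigr => k _.
rewrite mxE; apply: hc_mul_shift => m; rewrite -mcoeff_msupp.
by case: F_deg => h _ /h.
Qed.

Lemma fpart_aug j (v : 'rV[R]_(fc_rank F 0)) :
  hc j 0 ((v *m fc_aug F) 0 0) = (fpart j v *m fc_aug F) 0 0.
Proof.
rewrite !mxE linear_sum; apply: eq_bigr => k _.
rewrite mxE; apply: hc_mul_shift => m; rewrite -mcoeff_msupp addn0.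
by case: F_deg => _ /(_ k)/dhomogP h /h.
Qed.

Lemma fhom_dl i j (y : {set 'I_n} -> 'rV[R]_(fc_rank F i)) S :
  (forall S, fhom j (y S)) -> fhom j.+1 (dl xs y S).
Proof.
move=> hy l; rewrite /dl summxE; apply: mono_sum => k _.
have : mono (fun m => mdeg m + fc_shift l == j.+1)%N (xs k * y (k |: S) 0 l).
  have hk : mono (fun m => mdeg m == 1)%N (xs k) by apply/monoXm; rewrite mdeg1.
  apply: (mono2M _ hk (hy (k |: S) l)) => a b /eqP a1 /eqP <-.
  by rewrite mdegD a1 -addnA add1n.
by case: sb; rewrite /= !mxE //; apply: monoN.
Qed.

Lemma diff_exact i (v : 'rV[R]_(fc_rank F i.+1)) :
  v *m fc_diff F i = 0 <-> mximage (fc_diff F i.+1) v.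
Proof. by case: F_res => _ _ /(_ i v). Qed.

(* Computes [Tor] of the [t]-th syzygy module with the residue field by the
   Koszul complex, shifting one step along the resolution at a time. *)
Lemma syzygy_koszul i t j (y : {set 'I_n} -> 'rV[R]_(fc_rank F t)) :
    (t + r < j)%N -> (forall S, fhom j (y S)) ->
    (forall S, #|S|.+1 = i -> mximage (fc_diff F t) (dl xs y S)) ->
  exists w, forall S, #|S| = i -> mximage (fc_diff F t) (y S - dl xs w S).
Proof.
elim: i t j y => [|i IH] t j y tj hy hdl.
  pose z S := if S == set0 then y S else 0.
  have [//|//|l|S|w [_ hw]] := @koszul_free_row K n _ predT predT z.
  (* The degree [j] exceeds every shift in position [t], so [y] has no constant entries. *)
  - rewrite /z eqxx; apply/eqP; apply: contraTT tj => /hy.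
    by rewrite mdeg0 add0n => /eqP <-; rewrite -leqNgt.
  - rewrite /dl big1 // => k _; rewrite /z ifN ?scaler0 ?sv0 //.
    by apply/set0Pn; exists k; rewrite setU11.
  exists w => S /eqP; rewrite cards_eq0 => S0; have := hw S; rewrite /z S0 => ->.
  by rewrite subrr; case: (submod_mximage (fc_diff F t)).
have /choice_fun[u0 hu0] : forall S, exists u, #|S| = i -> dl xs y S = u *m fc_diff F t.
  move=> S; have [cS|nS] := eqVneq #|S| i; last by exists 0 => cS; rewrite cS eqxx in nS.
  by have [u hu] := hdl S (congr1 succn cS); exists u.
pose u S := fpart j.+1 (u0 S).
have hu S : #|S| = i -> dl xs y S = u S *m fc_diff F t.
  move=> cS; rewrite -fpart_diff -hu0 // fpart_id //; exact: fhom_dl.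
have [|S|S cS|w hw] := IH t.+1 j.+1 u; first by rewrite addSn ltnS.
- exact: fpart_hom.
- apply/diff_exact; rewrite -dl_mulmx -[RHS](dl_dl xs y S); apply: eq_dl => k kS.
  by rewrite hu // cardsU1 kS.
(* Correcting [y] inside the image turns a cycle modulo the image into a cycle of the free
   module. *)
pose z S := if #|S| == i.+1 then y S - w S *m fc_diff F t else 0.
have [//|//|l|S|v [_ hv]] := @koszul_free_row K n _ predT predT z.
- by rewrite /z cards0 mxE mcoeff0.
- have [cS|nS] := eqVneq #|S| i; last first.
    rewrite /dl big1 // => k kS; rewrite /z ifN ?scaler0 ?sv0 //.
    by rewrite cardsU1 kS eqSS.
  rewrite (eq_dl _ (c' := fun T => y T - w T *m fc_diff F t)) => [|k kS]; last first.
    by rewrite /z cardsU1 kS cS eqxx.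
  rewrite dlB dl_mulmx hu // -mulmxBl.
  by apply/diff_exact; apply: hw.
exists v => S cS; exists (w S); have := hv S; rewrite /z cS eqxx => <-.
by rewrite subKr.
Qed.

End Regularity.

Section FromRegularity.

Variables (K : fieldType) (n : nat) (e : rel 'I_n).
Hypothesis e_edge : exists i j, e i j.
Local Notation R := {mpoly K[n]}.
Local Notation xs := (@xs K n).
Local Notation J := (cover_ideal K e).
Local Notation d := (n - alpha0 e)%N.
Implicit Types (S T F : {set 'I_n}) (k : 'I_n).

(** The cycle [c] is placed in the multidegree of [s = ~: F] as a Koszul cycle [z] of the ideal,
    with coefficients of degree [n - q]. In the polynomial ring [z] is the boundary of some [y] of
    degree [n - q - 1], which is a cycle modulo the ideal; that degree exceeds [alpha0 e - 1], so
    [syzygy_koszul] applies. *)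
Theorem regularity_chexact : is_regularity J (alpha0 e - 1) -> chexact K (indep e) d.
Proof.
case=> C [[C_deg C_res _] [_ C_max]].
have a0 : (0 < alpha0 e)%N by case: e_edge => i [j] /alpha0_gt0.
have C_reg i (k : 'I_(fc_rank C i)) : (fc_shift k <= i + (alpha0 e - 1))%N.
  have [h|/ltnW/leq_trans->//] := leqP i (fc_shift k); last exact: leq_addr.
  rewrite -leq_subLR; apply: C_max; exists i, (fc_shift k); rewrite subnKC //.
  by split=> //; apply/eqP; rewrite -lt0n; apply/card_gt0P; exists k; rewrite inE.
have JI : is_ideal J by exact: ideal_gen_is_ideal.
have JS : submod (J : R^o -> Prop) by apply: ideal_submod.
move=> F q c qd c0 hc; pose s := ~: F.
have Fdis S : [disjoint S & F] = (S \subset s) by rewrite disjoints_subset.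
have [qF|Fq] := ltnP q #|F|.
  exists (fun=> 0); split=> // S /subset_leq_card h cS.
  by rewrite cS leqNgt qF in h.
pose cq T : K^o := if #|T| == q then c T else 0.
have cardSF S : S \subset s -> #|S :|: F| = (#|S| + #|F|)%N.
  rewrite -Fdis => dis; rewrite -cardsUI [X in (_ + X)%N](_ : _ = 0%N) ?addn0 //.
  by apply/eqP; rewrite cards_eq0 setI_eq0.
have sub_s S : S \subset s -> s :\: S = ~: (S :|: F) by rewrite setCU setDE setIC.
pose z S : R^o := tw F cq S *: 'X_[mesym1 (s :\: S)].
have twz S : tw F cq S != 0 -> [/\ S \subset s, #|S :|: F| = q & indep e (S :|: F)].
  rewrite /tw Fdis; case: ifP => [Ss|]; last by rewrite eqxx.
  rewrite /cq; have [cS|_] := eqVneq #|S :|: F| q; last by rewrite sv0 eqxx.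
  by move=> h; split=> //; apply: contraNT h => /c0 ->; rewrite sv0.
have dl_z S : dl xs z S = 0.
  have [Ss|nSs] := boolP (S \subset s); last first.
    rewrite /dl big1 // => k kS; rewrite /z /tw Fdis ifN ?scale0r ?scaler0 ?sv0 //.
    by apply: contra nSs; apply: subset_trans; apply: subsetUr.
  have -> : dl xs z S = dl (fun=> 1) (tw F cq) S *: 'X_[mesym1 (s :\: S)].
    rewrite /dl scaler_suml; apply: eq_bigr => k kS; rewrite scale1r /z.
    have [ks|ks] := boolP (k \in s); last first.
      have kF : k \in F by move: ks; rewrite inE negbK.
      by rewrite /tw disjoint_setU1 kF /= scale0r scaler0 !sv0 scale0r.
    have -> : 'X_[mesym1 (s :\: S)] = xs k * 'X_[mesym1 (s :\: (k |: S))] :> R.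
      rewrite /xs -mpolyXD addmC -mesym1U1; last by rewrite !inE eqxx.
      congr 'X_[mesym1 _]; apply/setP => i; rewrite !inE.
      by case: eqP => [->|_] //=; rewrite kS; move: ks; rewrite inE.
    set t := tw _ _ _; set X := 'X_[_].
    have -> : xs k *: ((t *: X : R) : R^o) = (t *: (xs k * X) : R).
      exact: esym (scalerAr t (xs k) (X : R)).
    by case: sb; rewrite /= ?scaleNr.
  rewrite dl_tw ?Fdis // (_ : dl _ _ _ = 0) ?sv0 ?scale0r //.
  have [cS|nS] := eqVneq #|S :|: F|.+1 q; last first.
    rewrite /dl big1 // => k kS; rewrite /cq cardsU1 kS add1n (negPf nS).
    by rewrite scaler0 sv0.
  rewrite -[RHS](hc (S :|: F)) ?subsetUr //; apply: eq_dl => k kS.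
  by rewrite /cq cardsU1 kS add1n cS eqxx.
have qn : (alpha0 e < n - q)%N by have := alpha0_le e; move: qd; clear; lia.
have [m k|S||//|y [ydeg hy]] := @koszul_free K n
    (fun m => mdeg m == n - q - 1)%N (fun m => mdeg m == n - q)%N z.
- by rewrite mdegD mdeg1 => /eqP <-; rewrite addnK.
- have [tw0|/twz[Ss cS _]] := eqVneq (tw F cq S) 0.
    by rewrite /z tw0 scale0r; apply: mono0.
  apply: monoZ; apply/monoXm; rewrite mdeg_mesym1 sub_s // -cS.
  by rewrite -[X in (X - _)%N]card_ord -(cardsC (S :|: F)) addKn.
- apply/eqP; rewrite /z mcoeffZ mcoeffX; have [h|_] := eqVneq _ 0%MM; last by rewrite mulr0.
  have [->|/twz[Ss cS _]] := eqVneq (tw F cq set0) 0; first by rewrite mul0r.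
  have := congr1 (@mdeg n) h; rewrite mdeg0 mdeg_mesym1 sub_s // => cC.
  have := cardsC (set0 :|: F); rewrite cC cS card_ord addn0 => qe.
  by rewrite qe subnn in qn.
have JEs m f : J f -> (f : R)@_m != 0 -> vertex_cover e (supp m).
  by move/cover_idealE; apply.
have zJ S : J (z S).
  have [tw0|/twz[Ss cS iS]] := eqVneq (tw F cq S) 0.
    by rewrite /z tw0 scale0r; case: JI.
  apply/cover_idealE; apply: monoZ; apply/monoXm.
  by rewrite supp_mesym1 sub_s.
pose aug (v : 'rV[R]_(fc_rank C 0)) : R^o := (v *m fc_aug C) 0 0.
have augB u v : aug (u - v) = aug u - aug v by rewrite /aug mulmxBl !mxE.
have dl_aug (v : {set 'I_n} -> 'rV[R]_(fc_rank C 0)) S :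
    aug (dl xs v S) = dl xs (fun T => aug (v T)) S.
  rewrite /aug -dl_mulmx /dl summxE; apply: eq_bigr => k _.
  by case: sb; rewrite /= !mxE.
have /choice_fun[v0 hv0] : forall S, exists v, J (y S - aug v).
  by move=> S; case: C_res => h _ _; apply: h.
pose v S := fpart (n - q - 1) (v0 S).
have hv S : J (y S - aug (v S)).
  have := hv0 S; move=> /cover_idealE h; apply/cover_idealE.
  pose Q (m : 'X_{1..n}) := (mdeg m + 0 == n - q - 1)%N.
  have e1 : mpart Q (y S : R) = y S.
    by apply: mpart_mono; apply: eq_mono (ydeg S) => m; rewrite /Q addn0.
  have e2 : mpart Q (aug (v0 S) : R) = aug (v S) by apply: fpart_aug.
  have -> : y S - aug (v S) = mpart Q (y S - aug (v0 S) : R).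
    by rewrite -[in LHS]e1 -e2; apply/esym/linearB.
  exact: mono_mpartI.
have imJ (u : 'rV[R]_(fc_rank C 0)) : mximage (fc_diff C 0) u <-> J (aug u).
  by case: C_res => _ h _; apply: iff_sym; apply: h.
have [||S cS|w hw] := @syzygy_koszul K n C J (alpha0 e - 1) C_deg C_res C_reg
    (q - #|F|).+1 0%N (n - q - 1)%N v.
- by move: qn a0; clear; lia.
- by move=> S; apply: fpart_hom.
- apply/imJ; rewrite dl_aug -[dl _ _ _](subKr (z S)); apply: submodB => //.
  by rewrite hy -dlB; apply: dl_mem.
(* Subtracting a boundary moves [y] into the ideal on sets of the relevant size and keeps its
   boundary [z]; the strand of [p] is the chain sought. *)
pose p S : R^o := y S - dl xs (fun T => aug (w T)) S.
have pJ S : #|S| = (q - #|F|).+1 -> J (p S).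
  move=> cS; have /imJ := hw S cS; rewrite augB dl_aug => h.
  case: JI => _ JD _; have := JD _ _ (hv S) h; by rewrite addrA subrK.
have dl_p S : dl xs p S = z S by rewrite dlB dl_dl subr0 -hy.
pose a := mesym1 s; have leS S : (mesym1 S <= a)%MM = (S \subset s).
  by rewrite mesym1_le supp_mesym1.
pose b T : K^o := if (F \subset T) && (#|T| == q.+1)
  then sv (et F (T :\: F)) (strand a p (T :\: F)) else 0.
have disD S : S \subset s -> (S :|: F) :\: F = S.
  by rewrite -Fdis setDUl setDv setU0 => /setDidPl.
have subD T : F \subset T -> T :\: F :|: F = T.
  by move=> FT; rewrite setUC setDE setUIr setUCr setIT; apply/setUidPr.
exists b; split=> [T|T FT cT].
  apply: contraNeq; rewrite /b; case: ifP => [/andP[FT /eqP cT]|]; last by rewrite eqxx.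
  rewrite /strand leS; case: ifP => [Ts|]; last by rewrite sv0 eqxx.
  rewrite mesym1D // sub_s // subD // => h.
  have cTF : #|T :\: F| = (q - #|F|).+1 by rewrite cardsD (setIidPr FT) cT subSn.
  have := JEs (mesym1 (~: T)) (p (T :\: F)) (pJ _ cTF); rewrite supp_mesym1; apply.
  by apply: contraNneq h => ->; rewrite sv0.
have Ts : T :\: F \subset s by rewrite setDE subsetIr.
apply: (can_inj (svK (et F (T :\: F)))).
have := @dl_tw K n F b (T :\: F); rewrite Fdis subD // => /(_ Ts) <-.
have -> : sv (et F (T :\: F)) (c T) = strand a z (T :\: F).
  rewrite /strand leS Ts /z mesym1D // mcoeffZ mcoeffX eqxx mulr1.
  by rewrite /tw Fdis Ts subD // /cq cT eqxx.
have aT : (mesym1 (T :\: F) <= a)%MM by rewrite leS.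
rewrite /strand aT -dl_p strand_dl //; apply: eq_dl => k kT.
rewrite /tw Fdis; case: ifPn => ks; last by rewrite /strand leS (negPf ks).
rewrite /b subsetUr cardSF // cardsU1 kT cardsD (setIidPr FT) cT.
by rewrite add1n addSn subnK // eqxx disD // svK.
Qed.

End FromRegularity.

Theorem corollary3p9 (K : fieldType) (n : nat) (e : rel 'I_n)
    (e_sym : ssrbool.symmetric e) (e_irr : irreflexive e)
    (e_edge : exists i j, e i j) :
  cohen_macaulay (edge_ideal K e) <->
  exists v r : nat,
    [/\ is_v_number (cover_ideal K e) v,
        is_regularity (cover_ideal K e) r,
        v = r & r = (alpha0 e - 1)%N].
Proof.
have subD (S T : {set 'I_n}) : S \subset T -> indep e T -> indep e S by exact: indepS.
split=> [/(cohen_macaulay_coexact _ e_irr) cx|[v [r [_ hr _ er]]]].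
  exists (alpha0 e - 1)%N, (alpha0 e - 1)%N; split=> //.
    by have [i [j eij]] := e_edge; apply: coexact_v_number eij.
  exact/chexact_regularity/(coexact_chexact subD).
apply/(cohen_macaulay_coexact _ e_irr)/(chexact_coexact subD).
by apply: regularity_chexact => //; rewrite -er.
Qed.
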